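(* Let $\mathcal{A}=\mathcal{A}(\mathbf{x},\mathbf{y},\mathsf{B})$ be a cluster algebra (with normalized coefficients in a semifield $\mathbb{P}$), and let $\mathcal{U}$ be its upper cluster algebra. If $\mathcal{A}$ is acyclic or locally acyclic, then $\mathcal{A}=\mathcal{U}$.
   Context: Semifields and seeds. A semifield $\mathbb{P}$ is a torsion-free abelian group (written multiplicatively) with an auxiliary addition $\oplus$ that is commutative, associative, and distributive over multiplication. $\mathbb{ZP}$ is its integral group ring. Let $\mathcal{F}$ be a field containing $\mathbb{ZP}$. A seed of rank $n$ in $\mathcal{F}$ is a triple $(\mathbf{x},\mathbf{y},\mathsf{B})$ where: the cluster $\mathbf{x}=\{x_1,\dots,x_n\}$ is an $n$-tuple in $\mathcal{F}$ that freely generates $\mathcal{F}$ as a field over the fraction field of $\mathbb{ZP}$ (i.e. the $x_i$ are algebraically independent over it and generate $\mathcal{F}$); the coefficients $\mathbf{y}=\{y_1,\dots,y_n\}$ form an $n$-tuple in $\mathbb{P}$; the exchange matrix $\mathsf{B}$ is an integral $n\times n$ matrix that is skew-symmetrizable (there is a diagonal matrix $\mathsf{D}$ with positive diagonal entries such that $\mathsf{D}\mathsf{B}$ is skew-symmetric). Mutation. Write $[b]_+=\max(b,0)$. The mutation of a seed at index $k$ is the seed $(\mu_k(\mathbf{x}),\mu_k(\mathbf{y}),\mu_k(\mathsf{B}))$, where $\mu_k(\mathbf{x})$ is obtained from $\mathbf{x}$ by replacing $x_k$ with $$x_k'=\frac{y_k\prod_j x_j^{[\mathsf{B}_{jk}]_+}+\prod_j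 x_j^{[-\mathsf{B}_{jk}]_+}}{(y_k\oplus 1)x_k};$$ $\mu_k(\mathbf{y})=\{y_1',\dots,y_n'\}$ with $y_k'=y_k^{-1}$ and $y_j'=y_jy_k^{[\mathsf{B}_{kj}]_+}(y_k\oplus1)^{-\mathsf{B}_{kj}}$ for $j\ne k$; and $\mu_k(\mathsf{B})_{ij}=-\mathsf{B}_{ij}$ if $i=k$ or $j=k$, and $\mu_k(\mathsf{B})_{ij}=\mathsf{B}_{ij}+\frac12(|\mathsf{B}_{ik}|\mathsf{B}_{kj}+\mathsf{B}_{ik}|\mathsf{B}_{kj}|)$ otherwise. Two seeds are mutation-equivalent if related by a sequence of mutations and (simultaneous) permutations of the indices. Cluster algebras. The cluster variables are the elements of all clusters of seeds mutation-equivalent to $(\mathbf{x},\mathbf{y},\mathsf{B})$; the cluster algebra $\mathcal{A}=\mathcal{A}(\mathbf{x},\mathbf{y},\mathsf{B})$ is the unital subring of $\mathcal{F}$ generated by $\mathbb{ZP}$ and all cluster variables. A seed of $\mathcal{A}$ is any seed mutation-equivalent to $(\mathbf{x},\mathbf{y},\mathsf{B})$, and a cluster in $\mathcal{A}$ is the cluster of such a seed. The upper cluster algebra is $$\mathcal{U}=\bigcap_{\text{clusters }\{x_1,\dots,x_n\}\text{ in }\mathcal{A}}\mathbb{ZP}[x_1^{\pm1},\dots,x_n^{\pm1}]\subset\mathcal{F}.$$ The Laurent phenomenon (a known fundamental theorem, which may be assumed) states $\mathcal{A}\subseteq\mathcal{U}$. Freezing. For a seed $(\mathbf{x},\mathbf{y},\mathsf{B})$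 of rank $n$, its freezing at $x_n$ is the seed $(\mathbf{x}^\dagger,\mathbf{y}^\dagger,\mathsf{B}^\dagger)$ of rank $n-1$ over the semifield $\mathbb{P}^\dagger=\mathbb{P}\times\mathbb{Z}$, where the generator of $\mathbb{Z}$ is denoted $x_n$ and $(p_1x_n^a)\oplus(p_2x_n^b)=(p_1\oplus p_2)x_n^{\min(a,b)}$ (so $\mathbb{ZP}^\dagger=\mathbb{ZP}[x_n^{\pm1}]\subset\mathcal{F}$, and the ambient field is still $\mathcal{F}$); $\mathbf{x}^\dagger=\{x_1,\dots,x_{n-1}\}$; $y_i^\dagger=y_ix_n^{\mathsf{B}_{ni}}$ for $1\le i\le n-1$; $\mathsf{B}^\dagger$ is $\mathsf{B}$ with the $n$th row and column deleted. Freezing at another variable $x_i$ is defined by conjugating with a permutation sending $x_i$ to $x_n$; freezing at a subset $S\subset\mathbf{x}$ is iterated freezing at each variable of $S$, in any order. (A seed of rank $0$ has cluster algebra and upper cluster algebra both equal to its coefficient ring.) Cluster localizations and covers. If $(\mathbf{x}^\dagger,\mathbf{y}^\dagger,\mathsf{B}^\dagger)$ is the freezing of a seed $(\mathbf{x},\mathbf{y},\mathsf{B})$ of $\mathcal{A}$ at $\{x_{i_1},\dots,x_{i_k}\}$ and $\mathcal{A}(\mathbf{x}^\dagger,\mathbf{y}^\dagger,\mathsf{B}^\dagger)=\mathcal{A}[(x_{i_1}\cdots x_{i_k})^{-1}]$ in $\mathcal{F}$, then $\mathcal{A}(\mathbf{x}^\dagger,\mathbf{y}^\dagger,\mathsf{B}^\dagger)$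 is called a cluster localization of $\mathcal{A}$. A set $\{\mathcal{A}_i\}_{i\in I}$ of cluster localizations of $\mathcal{A}$ (not necessarily from the same seed) is a cover of $\mathcal{A}$ if for every prime ideal $P$ of $\mathcal{A}$ there is some $i$ with $\mathcal{A}_iP\subsetneq\mathcal{A}_i$. Isolated, acyclic, locally acyclic. $\mathcal{A}$ is isolated if the exchange matrix of any seed (equivalently, every seed) of $\mathcal{A}$ is the zero matrix. $\mathcal{A}$ is acyclic if it has an acyclic seed, i.e. a seed with exchange matrix $\mathsf{B}$ for which there is no sequence of indices $i_1,\dots,i_\ell$ ($\ell\ge2$) with $\mathsf{B}_{i_{j+1}i_j}>0$ for all $1\le j<\ell$ and $i_\ell=i_1$. $\mathcal{A}$ is locally acyclic if it admits a cover by isolated cluster algebras. *)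

(* Defs.v *)
From HB Require Import structures.
From mathcomp Require Import all_boot all_order perm all_algebra.
From mathcomp Require Import finmap monalg boolp classical_sets.

Set Implicit Arguments.
Unset Strict Implicit.
Unset Printing Implicit Defensive.

Import Order.TTheory GRing.Theory Num.Theory.

Local Open Scope fset_scope.
Local Open Scope ring_scope.

HB.mixin Record Group_isSemifield P of Group P := {
  sf_mulC : commutative (@monoid.mul P);
  sf_torsion_free : forall (p : P) (m : nat),
    (0 < m)%N -> (p ^+ m)%g = 1%g -> p = 1%g;
  oplus : P -> P -> P;
  oplusC : commutative oplus;
  oplusA : associative oplus;
  sf_mulDr : right_distributive (@monoid.mul P) oplus
}.

#[short(type="semifieldType")]
HB.structure Definition Semifield := { P of Group_isSemifield P & Group P }.

Definition expgz (P : groupType) (p : P) (z : int) : P :=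
  match z with Posz m => (p ^+ m)%g | Negz m => (p ^- m.+1)%g end.

(* The ring structure that the library puts on {malg R[K]} requires the
   monoid K to have no unit but 1, hence the alias. *)
Definition group_ring (P : semifieldType) : Type := {malg int[P]}.

HB.instance Definition _ (P : semifieldType) := GRing.Zmodule.on (group_ring P).

Section GroupRing.
Variable P : semifieldType.
Implicit Types (u v w : group_ring P) (p q : P).

Definition group_ring_one : group_ring P := << 1 *g 1%g >>.

Definition group_ring_mul u v : group_ring P :=
  \sum_(p <- msupp u) \sum_(q <- msupp v) << u@_p * v@_q *g (p * q)%g >>.

Local Notation gmul := group_ring_mul.

Lemma group_ring_mulw (d1 d2 : {fset P}) u v :
  msupp u `<=` d1 -> msupp v `<=` d2 ->
  gmul u v = \sum_(p <- d1) \sum_(q <- d2) << u@_p * v@_q *g (p * q)%g >>.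
Proof.
move=> le1 le2; rewrite /group_ring_mul (big_fset_incl _ le1) /=.
  apply/eq_bigr=> p _; apply/big_fset_incl => // q _ /mcoeff_outdom ->.
  by rewrite mulr0 monalgU0.
move=> p _ /mcoeff_outdom up.
by rewrite big1 // => q _; rewrite up mul0r monalgU0.
Qed.

Lemma group_ring_mulUU (c1 c2 : int) p q :
  gmul << c1 *g p >> << c2 *g q >> = << c1 * c2 *g (p * q)%g >>.
Proof.
by rewrite (group_ring_mulw msuppU_le msuppU_le) !big_seq_fset1 !mcoeffUU.
Qed.

Lemma group_ring_mulC : commutative gmul.
Proof.
move=> u v; rewrite /group_ring_mul exchange_big /=.
by apply/eq_bigr=> q _; apply/eq_bigr=> p _; rewrite mulrC sf_mulC.
Qed.

Lemma group_ring_mulDl : left_distributive gmul +%R.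
Proof.
move=> u v w.
rewrite (group_ring_mulw (msuppD_le u v) (fsubset_refl (msupp w))).
rewrite (group_ring_mulw (fsubsetUl _ (msupp v)) (fsubset_refl (msupp w))).
rewrite (group_ring_mulw (fsubsetUr (msupp u) _) (fsubset_refl (msupp w))).
rewrite -big_split /=; apply/eq_bigr=> p _.
rewrite -big_split /=; apply/eq_bigr=> q _.
by rewrite mcoeffD mulrDl monalgUD.
Qed.

Lemma group_ring_mulDr : right_distributive gmul +%R.
Proof.
move=> u v w; rewrite group_ring_mulC group_ring_mulDl.
by rewrite ![gmul _ u]group_ring_mulC.
Qed.

Lemma group_ring_mul0 u : gmul 0 u = 0.
Proof. by rewrite /group_ring_mul msupp0 big_seq_fset0. Qed.

Lemma group_ring_mulr0 u : gmul u 0 = 0.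
Proof. by rewrite group_ring_mulC group_ring_mul0. Qed.

Lemma group_ring_suml (I : Type) (r : seq I) (f : I -> group_ring P) v :
  gmul (\sum_(i <- r) f i) v = \sum_(i <- r) gmul (f i) v.
Proof.
exact: (big_morph (gmul^~ v) (fun _ _ => group_ring_mulDl _ _ _)
                  (group_ring_mul0 _)).
Qed.

Lemma group_ring_sumr (I : Type) (r : seq I) (f : I -> group_ring P) v :
  gmul v (\sum_(i <- r) f i) = \sum_(i <- r) gmul v (f i).
Proof.
exact: (big_morph (gmul v) (fun _ _ => group_ring_mulDr _ _ _)
                  (group_ring_mulr0 _)).
Qed.

Lemma group_ring_mul1 : left_id group_ring_one gmul.
Proof.
move=> u; rewrite [in LHS](monalgE u) group_ring_sumr [RHS](monalgE u).
by apply/eq_bigr=> p _; rewrite group_ring_mulUU mul1r mul1g.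
Qed.

Lemma group_ring_mulA : associative gmul.
Proof.
move=> u v w.
rewrite (monalgE u) group_ring_suml [gmul (bigop _ _ _) v]group_ring_suml.
rewrite group_ring_suml; apply: eq_bigr => p _.
rewrite (monalgE v) [gmul (bigop _ _ _) w]group_ring_suml.
rewrite [gmul _ (bigop _ _ _)]group_ring_sumr.
rewrite [gmul _ (bigop _ (msupp v) _)]group_ring_sumr group_ring_suml.
apply: eq_bigr => q _.
rewrite (monalgE w) [gmul << _ *g q >> _]group_ring_sumr.
rewrite [gmul << _ *g p >> _]group_ring_sumr [RHS]group_ring_sumr.
by apply: eq_bigr => r _; rewrite !group_ring_mulUU mulrA mulgA.
Qed.

Lemma group_ring_one_neq0 : group_ring_one != 0.
Proof. by rewrite monalgU_eq0. Qed.

End GroupRing.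

HB.instance Definition _ (P : semifieldType) :=
  GRing.Zmodule_isComNzRing.Build (group_ring P)
    (@group_ring_mulA P) (@group_ring_mulC P) (@group_ring_mul1 P)
    (@group_ring_mulDl P) (@group_ring_one_neq0 P).

Definition gr_elt (P : semifieldType) (p : P) : group_ring P := << 1 *g p >>.

(* Imported only here: mpoly reuses the names of monalg. *)
From mathcomp Require Import mpoly.

Local Open Scope classical_set_scope.
Local Open Scope ring_scope.

Definition subring_gen (F : fieldType) (G : set F) : set F :=
  smallest (fun A : set F => subring_closed (mem A)) G.

Definition subfield_gen (F : fieldType) (G : set F) : set F :=
  smallest (fun A : set F => divring_closed (mem A)) G.

Definition zmod_gen (F : fieldType) (G : set F) : set F :=
  smallest (fun A : set F => zmod_closed (mem A)) G.

Record seed (P : semifieldType) (F : fieldType) (n : nat) := Seed {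
  cluster : {ffun 'I_n -> F};
  coeffs : {ffun 'I_n -> P};
  exchange : 'M[int]_n
}.

(* A rational diagonal matrix with positive entries can be taken integral by
   clearing denominators. *)
Definition skew_symmetrizable (n : nat) (B : 'M[int]_n) : Prop :=
  exists d : 'rV[rat]_n, (forall i, 0 < d 0 i) /\
    (diag_mx d *m map_mx intr B)^T = - (diag_mx d *m map_mx intr B).

Section Clusters.
Variables (P : semifieldType) (F : fieldType).

(* Throughout, the inclusion of the group ring of P in the ambient field F is
   a map iota : group_ring P -> F; it is a plain function because the
   inclusion attached to a freezing is only a ring morphism under
   hypotheses on the frozen variable. *)
Variable iota : group_ring P -> F.

Definition frac_field : set F := subfield_gen (range iota).

Definition alg_independent (n : nat) (x : 'I_n -> F) : Prop :=
  forall p : mpoly n F,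
    p \is a mpolyOver n (mem frac_field) -> p.@[x] = 0 -> p = 0.

Definition freely_generates (n : nat) (x : 'I_n -> F) : Prop :=
  alg_independent x /\ subfield_gen (frac_field `|` range x) = [set: F].

Definition is_seed (n : nat) (s : seed P F n) : Prop :=
  freely_generates (cluster s) /\ skew_symmetrizable (exchange s).

Definition pos_part (b : int) : int := Num.max b 0.

Definition mutate_cluster (n : nat) (s : seed P F n) (k : 'I_n) :
    {ffun 'I_n -> F} :=
  let x := cluster s in let y := coeffs s in let B := exchange s in
  [ffun i => if i == k then
     (iota (gr_elt (y k)) * \prod_j x j ^ pos_part (B j k)
        + \prod_j x j ^ pos_part (- B j k))
     / (iota (gr_elt (oplus (y k) 1%g)) * x k)
   else x i].

Definition mutate_coeffs (n : nat) (s : seed P F n) (k : 'I_n) :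
    {ffun 'I_n -> P} :=
  let y := coeffs s in let B := exchange s in
  [ffun j => if j == k then (y k)^-1%g
   else (y j * expgz (y k) (pos_part (B k j))
             * expgz (oplus (y k) 1) (- B k j))%g].

(* The division by 2 is exact: the summands are equal up to sign. *)
Definition mutate_exchange (n : nat) (B : 'M[int]_n) (k : 'I_n) : 'M[int]_n :=
  \matrix_(i, j) if (i == k) || (j == k) then - B i j
    else B i j + ((`|B i k| * B k j + B i k * `|B k j|) %/ 2)%Z.

Definition mutate (n : nat) (s : seed P F n) (k : 'I_n) : seed P F n :=
  Seed (mutate_cluster s k) (mutate_coeffs s k)
       (mutate_exchange (exchange s) k).

Definition permute (n : nat) (s : seed P F n) (w : 'S_n) : seed P F n :=
  Seed [ffun i => cluster s (w i)] [ffun i => coeffs s (w i)]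
       (\matrix_(i, j) exchange s (w i) (w j)).

Inductive mutation_equivalent (n : nat) (s : seed P F n) :
    seed P F n -> Prop :=
| MutRefl : mutation_equivalent s s
| MutMutate t k : mutation_equivalent s t -> mutation_equivalent s (mutate t k)
| MutPermute t w :
    mutation_equivalent s t -> mutation_equivalent s (permute t w).

Definition cluster_variables (n : nat) (s : seed P F n) : set F :=
  [set z | exists2 t, mutation_equivalent s t & range (cluster t) z].

Definition cluster_algebra (n : nat) (s : seed P F n) : set F :=
  subring_gen (range iota `|` cluster_variables s).

Definition laurent_ring (n : nat) (x : 'I_n -> F) : set F :=
  subring_gen (range iota `|` range x `|` range (fun i => (x i)^-1)).

Definition upper_cluster_algebra (n : nat) (s : seed P F n) : set F :=
  \bigcap_(t in [set t | mutation_equivalent s t]) laurent_ring (cluster t).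

Definition isolated (n : nat) (s : seed P F n) : Prop :=
  forall t, mutation_equivalent s t -> exchange t = 0.

(* The sequence i_1, ..., i_l of the definition is i :: c, so c is nonempty. *)
Definition acyclic_exchange (n : nat) (B : 'M[int]_n) : Prop :=
  ~ exists (i : 'I_n) (c : seq 'I_n),
      [/\ c <> [::], path (fun j l => 0 < B l j) i c & last i c = i].

Definition acyclic (n : nat) (s : seed P F n) : Prop :=
  exists2 t, mutation_equivalent s t & acyclic_exchange (exchange t).

End Clusters.

(* The pair (p, a) stands for p * x ^ a, with x the frozen variable. *)
Definition frozen_semifield (P : semifieldType) : Type := (P * int)%type.

HB.instance Definition _ (P : semifieldType) :=
  Choice.copy (frozen_semifield P) (P * int)%type.

Section FrozenSemifield.
Variable P : semifieldType.
Local Notation Pf := (frozen_semifield P).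

Definition frozen_one : Pf := (1%g, 0).
Definition frozen_inv (u : Pf) : Pf := (u.1^-1%g, - u.2).
Definition frozen_mul (u v : Pf) : Pf := ((u.1 * v.1)%g, u.2 + v.2).
Definition frozen_oplus (u v : Pf) : Pf := (oplus u.1 v.1, Num.min u.2 v.2).

Lemma frozen_mulA : associative frozen_mul.
Proof. by move=> u v w; rewrite /frozen_mul /= mulgA addrA. Qed.
Lemma frozen_mul1g : left_id frozen_one frozen_mul.
Proof. by case=> p a; rewrite /frozen_mul /= mul1g add0r. Qed.
Lemma frozen_mulg1 : right_id frozen_one frozen_mul.
Proof. by case=> p a; rewrite /frozen_mul /= mulg1 addr0. Qed.
Lemma frozen_mulVg : left_inverse frozen_one frozen_inv frozen_mul.
Proof. by case=> p a; rewrite /frozen_mul /= mulVg addNr. Qed.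
Lemma frozen_mulgV : right_inverse frozen_one frozen_inv frozen_mul.
Proof. by case=> p a; rewrite /frozen_mul /= mulgV subrr. Qed.

HB.instance Definition _ := isGroup.Build Pf
  frozen_mulA frozen_mul1g frozen_mulg1 frozen_mulVg frozen_mulgV.

Lemma frozen_mulC : commutative (@monoid.mul Pf).
Proof. by move=> u v; congr pair; [exact: sf_mulC | exact: addrC]. Qed.

Lemma frozen_expgE (u : Pf) (m : nat) :
  (u ^+ m)%g = ((u.1 ^+ m)%g, u.2 *+ m) :> Pf.
Proof.
elim: m => [//|m IHm]; rewrite expgS IHm mulrS expgS.
by [].
Qed.

Lemma frozen_torsion_free (u : Pf) (m : nat) :
  (0 < m)%N -> (u ^+ m)%g = 1%g -> u = 1%g.
Proof.
move=> m0; rewrite frozen_expgE => -[/(sf_torsion_free _ _ m0) u1 /eqP].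
by rewrite mulrn_eq0 eqn0Ngt m0 => /eqP u2; case: u u1 u2 => p a /= -> ->.
Qed.

Lemma frozen_oplusC : commutative frozen_oplus.
Proof. by move=> u v; rewrite /frozen_oplus oplusC minC. Qed.

Lemma frozen_oplusA : associative frozen_oplus.
Proof. by move=> u v w; rewrite /frozen_oplus /= oplusA minA. Qed.

Lemma frozen_mulDr : right_distributive (@monoid.mul Pf) frozen_oplus.
Proof.
by move=> u v w; congr pair; [exact: sf_mulDr | exact: addr_minr].
Qed.

HB.instance Definition _ := Group_isSemifield.Build Pf
  frozen_mulC frozen_torsion_free frozen_oplusC frozen_oplusA frozen_mulDr.
End FrozenSemifield.

(* The inclusion in F of the group ring of the frozen semifield, x being the
   frozen variable: Z-linear, with (p, a) |-> p * x ^ a. *)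
Definition freeze_iota (P : semifieldType) (F : fieldType)
    (iota : group_ring P -> F) (x : F) :
    group_ring (frozen_semifield P) -> F :=
  monalg.mmap intr (fun u : frozen_semifield P => iota (gr_elt u.1) * x ^ u.2).

(* lift i : 'I_n.-1 -> 'I_n enumerates the indices other than i; for the last
   index it is the identity on 0 .. n-2, and in general it is the restriction
   of a permutation of 'I_n sending the last index to i. *)
Definition freeze_seed (P : semifieldType) (F : fieldType) (n : nat)
    (s : seed P F n) (i : 'I_n) : seed (frozen_semifield P) F n.-1 :=
  Seed [ffun j => cluster s (lift i j)]
       [ffun j => (coeffs s (lift i j), exchange s i (lift i j))
                    : frozen_semifield P]
       (row' i (col' i (exchange s))).

(* Freezing changes the semifield, its inclusion in F and the rank, so
   iterated freezings are compared through seeds bundled with these data. *)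
Record based_seed (F : fieldType) := BasedSeed {
  base_semifield : semifieldType;
  base_iota : group_ring base_semifield -> F;
  base_rank : nat;
  base_seed : seed base_semifield F base_rank
}.
Arguments base_iota [F] b _.

Definition freeze (F : fieldType) (b : based_seed F) (i : 'I_(base_rank b)) :
    based_seed F :=
  BasedSeed (freeze_iota (base_iota b) (cluster (base_seed b) i))
            (freeze_seed (base_seed b) i).

Definition base_algebra (F : fieldType) (b : based_seed F) : set F :=
  cluster_algebra (base_iota b) (base_seed b).

(* is_freezing b v c : c is obtained from b by freezing successively the
   variables in the list v (latest first). *)
Inductive is_freezing (F : fieldType) (b : based_seed F) :
    seq F -> based_seed F -> Prop :=
| FreezeNone : is_freezing b [::] b
| FreezeOne v c (i : 'I_(base_rank c)) :
    is_freezing b v c -> is_freezing b (cluster (base_seed c) i :: v) (freeze i).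

Definition prime_ideal (F : fieldType) (A I : set F) : Prop :=
  [/\ I `<=` A, zmod_closed (mem I),
      forall a p, A a -> I p -> I (a * p),
      ~ I 1 &
      forall a b, A a -> A b -> I (a * b) -> I a \/ I b].

Definition extended_ideal (F : fieldType) (A I : set F) : set F :=
  zmod_gen [set a * p | a in A & p in I].

Section LocallyAcyclic.
Variables (P : semifieldType) (F : fieldType).
Variable iota : group_ring P -> F.

Definition cluster_localization (n : nat) (s : seed P F n)
    (c : based_seed F) : Prop :=
  exists (t : seed P F n) (v : seq F),
    [/\ mutation_equivalent iota s t,
        is_freezing (BasedSeed iota t) v c &
        base_algebra c =
          subring_gen (cluster_algebra iota s `|` [set (\prod_(z <- v) z)^-1])].

Definition is_cover (n : nat) (s : seed P F n) (C : set (based_seed F)) : Prop :=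
  (forall c, C c -> cluster_localization s c) /\
  (forall I : set F, prime_ideal (cluster_algebra iota s) I ->
     exists2 c, C c &
       extended_ideal (base_algebra c) I `<` base_algebra c).

Definition locally_acyclic (n : nat) (s : seed P F n) : Prop :=
  exists2 C : set (based_seed F), is_cover s C &
    forall c, C c -> isolated (base_iota c) (base_seed c).

End LocallyAcyclic.

(* A theorem of Fomin and Zelevinsky, stated for all coefficient semifields,
   ambient fields and seeds. *)
Definition laurent_phenomenon : Prop :=
  forall (P : semifieldType) (F : fieldType)
    (iota : {rmorphism group_ring P -> F}) (n : nat) (s : seed P F n),
    injective iota -> is_seed iota s ->
    cluster_algebra iota s `<=` upper_cluster_algebra iota s.

(* Main.v *)
Require Import Defs.
From HB Require Import structures.
From mathcomp Require Import all_boot all_order perm all_algebra.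
From mathcomp Require Import finmap monalg boolp classical_sets mpoly.

(* Call a cluster free if each of its variables is transcendental over the
   field generated by the coefficients and the other variables.  Freeness
   survives mutation and freezing.  Freezing can only enlarge the upper cluster
   algebra, and in the cluster algebra it only inverts the frozen variable.

   If B = 0, mutation replaces x_k by w_k / x_k with w_k a coefficient, and U is
   computed one variable at a time from
     R[x, 1/x] /\ R[w/x, x/w] = R[x, w/x].

   If B is acyclic and nonzero, some sink l has an arrow from some j.  The
   exchange relation at l makes x_l and x_j comaximal in A, and by induction on
   the rank every element of U is moved into A by a power of x_l, and by a
   power of x_j.

   In the locally acyclic case let u be in U and J = {b in A | b u in A}.  Each
   A[1/z] of the cover contains U, so J contains a power of z and generates the
   unit ideal of A[1/z]. Hence no prime ideal of A contains J, so 1 is in J. *)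

Set Implicit Arguments.
Unset Strict Implicit.
Unset Printing Implicit Defensive.

Import Order.TTheory GRing.Theory Num.Theory.

Local Open Scope classical_set_scope.
Local Open Scope ring_scope.

(** * Subrings, subfields and transcendental elements *)

Section Subrings.
Variable F : fieldType.
Implicit Types (A B G : set F) (a b x : F).

Definition is_subring A : Prop :=
  [/\ A 1, forall a b, A a -> A b -> A (a - b)
         & forall a b, A a -> A b -> A (a * b)].

Lemma subring_closedP A : GRing.subring_closed (mem A) <-> is_subring A.
Proof.
split=> -[A1 AB AM]; split.
- by move: A1; rewrite inE.
- by move=> a b Aa Ab; move: (AB a b); rewrite !inE; apply.
- by move=> a b Aa Ab; move: (AM a b); rewrite !inE; apply.
- by rewrite inE.
- by move=> a b; rewrite !inE; apply: AB.
- by move=> a b; rewrite !inE; apply: AM.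
Qed.

Section Closure.
Variable A : set F.
Hypothesis Asub : is_subring A.

Lemma is_subring1 : A 1. Proof. by case: Asub. Qed.

Lemma is_subringB a b : A a -> A b -> A (a - b).
Proof. by case: Asub => _ + _; apply. Qed.

Lemma is_subringM a b : A a -> A b -> A (a * b).
Proof. by case: Asub => _ _; apply. Qed.

Lemma is_subring0 : A 0.
Proof. by rewrite -(subrr 1); apply: is_subringB; apply: is_subring1. Qed.

Lemma is_subringN a : A a -> A (- a).
Proof. by rewrite -[- a]sub0r; apply: is_subringB; apply: is_subring0. Qed.

Lemma is_subringD a b : A a -> A b -> A (a + b).
Proof. by move=> Aa Ab; rewrite -[b]opprK; apply/is_subringB/is_subringN. Qed.

Lemma is_subringX a m : A a -> A (a ^+ m).
Proof.
move=> Aa; elim: m => [|m IHm]; first exact: is_subring1.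
by rewrite exprS; apply: is_subringM.
Qed.

Lemma is_subring_sum I (r : seq I) (Q : pred I) (f : I -> F) :
  (forall i, Q i -> A (f i)) -> A (\sum_(i <- r | Q i) f i).
Proof.
move=> Af; apply: (big_ind A) => //; first exact: is_subring0.
exact: is_subringD.
Qed.

Lemma is_subring_prod I (r : seq I) (Q : pred I) (f : I -> F) :
  (forall i, Q i -> A (f i)) -> A (\prod_(i <- r | Q i) f i).
Proof.
move=> Af; apply: (big_ind A) => //; first exact: is_subring1.
exact: is_subringM.
Qed.

Lemma is_subring_int (z : int) : A z%:~R.
Proof.
have nat_in m : A m%:R.
  elim: m => [|m IHm]; first exact: is_subring0.
  by rewrite -addn1 natrD; apply: is_subringD => //; apply: is_subring1.
by case: z => m; [apply: nat_in | apply/is_subringN/nat_in].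
Qed.

Lemma is_subringXz a (z : int) : A a -> (z < 0 -> A a^-1) -> A (a ^ z).
Proof.
move=> Aa AVa; case: z AVa => m AVa; first exact: is_subringX.
by rewrite NegzE -exprz_inv; apply: is_subringX; apply: AVa.
Qed.

End Closure.

Lemma subring_gen_subring G : is_subring (subring_gen G).
Proof.
have gen_in A a : subring_gen G a -> is_subring A -> G `<=` A -> A a.
  by move=> Ga As GA; apply: Ga; split=> //; apply/subring_closedP.
split=> [|a b Ga Gb|a b Ga Gb] A [/= /subring_closedP As GA].
- exact: is_subring1.
- by apply: is_subringB => //; apply: gen_in.
- by apply: is_subringM => //; apply: gen_in.
Qed.

Lemma mem_subring_gen G : G `<=` subring_gen G.
Proof. by move=> x Gx A [_]; apply. Qed.

Lemma subring_gen_min G A : is_subring A -> G `<=` A -> subring_gen G `<=` A.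
Proof. by move=> Asub GA x; apply; split=> //; apply/subring_closedP. Qed.

Lemma subring_genS G H : G `<=` H -> subring_gen G `<=` subring_gen H.
Proof.
move=> GH; apply: subring_gen_min; first exact: subring_gen_subring.
exact: subset_trans GH (@mem_subring_gen H).
Qed.

Definition is_subfield A : Prop := is_subring A /\ forall a, A a -> A a^-1.

Lemma divring_closedP A : GRing.divring_closed (mem A) <-> is_subfield A.
Proof.
split=> [[A1 AB AD]|[[A1 AB AM] AV]].
  have {}A1 : A 1 by move: A1; rewrite inE.
  have {}AD a b : A a -> A b -> A (a / b).
    by move=> Aa Ab; move: (AD a b); rewrite !inE; apply.
  have AV a : A a -> A a^-1 by rewrite -[a^-1]mul1r; apply: AD.
  split=> //; split=> // a b Aa Ab.
    by move: (AB a b); rewrite !inE; apply.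
  by rewrite -[b]invrK; apply/AD/AV.
split=> [|a b|a b]; rewrite ?inE //; first exact: AB.
by move=> Aa Ab; apply/AM/AV.
Qed.

Lemma subfield_gen_subfield G : is_subfield (subfield_gen G).
Proof.
have gen_in A a : subfield_gen G a -> is_subfield A -> G `<=` A -> A a.
  by move=> Ga Af GA; apply: Ga; split=> //; apply/divring_closedP.
split; [split=> [|a b Ga Gb|a b Ga Gb]|move=> a Ga];
  move=> A [/= /divring_closedP Af GA]; case: (Af) => As AV.
- exact: is_subring1.
- by apply: is_subringB => //; apply: gen_in.
- by apply: is_subringM => //; apply: gen_in.
- by apply: AV; apply: gen_in.
Qed.

Lemma subfield_gen_subring G : is_subring (subfield_gen G).
Proof. by case: (subfield_gen_subfield G). Qed.

Lemma subfield_genV G a : subfield_gen G a -> subfield_gen G a^-1.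
Proof. by case: (subfield_gen_subfield G) => _; apply. Qed.

Lemma mem_subfield_gen G : G `<=` subfield_gen G.
Proof. by move=> x Gx A [_]; apply. Qed.

Lemma subfield_gen_min G A :
  is_subfield A -> G `<=` A -> subfield_gen G `<=` A.
Proof. by move=> Asub GA x; apply; split=> //; apply/divring_closedP. Qed.

Definition transcendental A x : Prop :=
  forall p : {poly F}, (forall i, A p`_i) -> p.[x] = 0 -> p = 0.

Lemma transcendentalS A B x :
  A `<=` B -> transcendental B x -> transcendental A x.
Proof. by move=> AB Bx p Ap; apply: Bx => i; apply: AB. Qed.

Lemma transcendental_neq0 A x : is_subring A -> transcendental A x -> x != 0.
Proof.
move=> As Ax; apply/eqP => x0.
have : 'X = 0 :> {poly F}.
  apply: Ax; last by rewrite hornerX.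
  by move=> i; rewrite coefX; case: eqP => _;
    [apply: is_subring1 | apply: is_subring0].
by move/eqP; rewrite polyX_eq0.
Qed.

(** Elements of the generated field are fractions over [A], and a common denominator of the finitely
    many coefficients turns a relation into one over [A]. *)
Lemma transcendental_frac A x :
  is_subring A -> transcendental A x -> transcendental (subfield_gen A) x.
Proof.
move=> As Ax.
pose Q := [set c | exists a b, [/\ A a, A b, b != 0 & c = a / b]].
have QA : subfield_gen A `<=` Q.
  apply: subfield_gen_min; last first.
    by move=> a Aa; exists a, 1; split; rewrite ?oner_neq0 ?divr1 //;
       apply: is_subring1.
  split; [split|].
  - by exists 1, 1; split; rewrite ?oner_neq0 ?divr1 //; apply: is_subring1.
  - move=> _ _ [a [b [Aa Ab b0 ->]]] [c [d [Ac Ad d0 ->]]].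
    exists (a * d - c * b), (b * d).
    split; last by rewrite -mulNr addf_div ?mulNr.
    + by apply: is_subringB => //; apply: is_subringM.
    + exact: is_subringM.
    + exact: mulf_neq0.
  - move=> _ _ [a [b [Aa Ab b0 ->]]] [c [d [Ac Ad d0 ->]]].
    exists (a * c), (b * d); split; last by rewrite mulf_div.
    + exact: is_subringM.
    + exact: is_subringM.
    + exact: mulf_neq0.
  - move=> _ [a [b [Aa Ab b0 ->]]]; have [-> | a0] := eqVneq a 0.
      exists 0, 1; split; rewrite ?oner_neq0 ?mul0r ?invr0 //.
        exact: is_subring0.
      exact: is_subring1.
    by exists b, a; split; rewrite ?invf_div.
move=> p Kp px0.
have [d [Ad d0 dp]] : exists d, [/\ A d, d != 0 & forall i, A (d * p`_i)].
  have [d [Ad d0 dp]] : exists d, [/\ A d, d != 0 &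
      forall i, (i < size p)%N -> A (d * p`_i)].
    elim: (size p) => [|m [d [Ad d0 dp]]].
      by exists 1; split; rewrite ?oner_neq0 //; apply: is_subring1.
    have [a [b [Aa Ab b0 pm]]] := QA _ (Kp m).
    exists (d * b); split; [exact: is_subringM | exact: mulf_neq0 | ].
    move=> i; rewrite ltnS leq_eqVlt => /orP[/eqP -> | im].
      by rewrite pm -mulrA [b * _]mulrC divfK //; apply: is_subringM.
    by rewrite mulrAC; apply: is_subringM => //; apply: dp.
  exists d; split=> // i; have [/dp //|/(nth_default 0) ->] := ltnP i (size p).
  by rewrite mulr0; apply: is_subring0.
have /eqP : d *: p = 0.
  by apply: Ax => [i|]; rewrite ?coefZ ?hornerZ ?px0 ?mulr0.
by rewrite scaler_eq0 (negPf d0) => /eqP.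
Qed.

(** The polynomial [X^m + c] is nonzero because [0 < m] keeps its leading coefficient apart from
    [c]. *)
Lemma transcendental_monomial A x (m : nat) c :
  is_subring A -> transcendental A x -> A c -> (0 < m)%N -> x ^+ m + c != 0.
Proof.
move=> As Ax Ac m0; apply/eqP => xc0.
have /(congr1 (coefp m)) : 'X^m + c%:P = 0 :> {poly F}.
  apply: Ax; last by rewrite !hornerE.
  move=> i; rewrite coefD coefXn coefC; apply: is_subringD => //.
    by case: eqP => _; [apply: is_subring1 | apply: is_subring0].
  by case: eqP => // _; apply: is_subring0.
rewrite /= coefD coefXn coefC coef0 eqxx -[m == 0]negbK -lt0n m0 addr0.
by move/eqP; rewrite oner_eq0.
Qed.

Lemma subring_gen_adjoin A b c : is_subring A ->
  subring_gen (A `|` [set b]) c ->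
  exists2 f : {poly F}, forall i, A f`_i & c = f.[b].
Proof.
move=> As; move: c; apply: subring_gen_min; last first.
  move=> c [Ac | /= ->]; [exists c%:P | exists 'X]; rewrite ?hornerE // => i.
    by rewrite coefC; case: eqP => // _; apply: is_subring0.
  by rewrite coefX; case: eqP => _; [apply: is_subring1 | apply: is_subring0].
split=> [|_ _ [f Af ->] [g Ag ->]|_ _ [f Af ->] [g Ag ->]].
- exists 1; rewrite ?hornerE // => i.
  by rewrite coef1; case: eqP => _; [apply: is_subring1 | apply: is_subring0].
- exists (f - g); rewrite ?hornerE // => i.
  by rewrite coefB; apply: is_subringB.
- exists (f * g); rewrite ?hornerE // => i; rewrite coefM.
  by apply: is_subring_sum => // j _; apply: is_subringM.
Qed.

(* Reads a relation for a with coefficients in A[b] as a relation for b with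
   coefficients in A[a]. *)
Lemma transcendental_exchange A a b : is_subring A ->
  transcendental A a -> transcendental (subring_gen (A `|` [set a])) b ->
  transcendental (subring_gen (A `|` [set b])) a.
Proof.
move=> As Aa Bb p Cp pa0.
have /choice [f fP] i : exists f : {poly F}, (forall m, A f`_m) /\ p`_i = f.[b].
  by have [f Af ->] := subring_gen_adjoin As (Cp i); exists f.
(* [Q] regroups the relation by powers of [b]: its value at [b] is [p.[a]], and its coefficients lie
   in [A[a]]. *)
pose Q : {poly F} := \sum_(i < size p) a ^+ i *: f i.
have Q0 : Q = 0.
  apply: Bb => [m|].
    have Ss := subring_gen_subring (A `|` [set a]).
    rewrite coef_sum; apply: (is_subring_sum Ss) => i _; rewrite coefZ.
    apply: (is_subringM Ss).
      by apply: (is_subringX Ss); apply: mem_subring_gen; right.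
    by apply: mem_subring_gen; left; case: (fP i).
  rewrite horner_sum -[RHS]pa0 horner_coef.
  by apply: eq_bigr => i _; rewrite hornerZ (fP i).2 mulrC.
(* Each coefficient of [Q] vanishes and is a polynomial in [a] over [A], so the transcendence of [a]
   kills the coefficients of that polynomial. *)
have f0 i m : (i < size p)%N -> (f i)`_m = 0.
  move=> ip.
  have r0 : \poly_(j < size p) (f j)`_m = 0.
    apply: Aa => [j|].
      by rewrite coef_poly; case: ifP => _; [case: (fP j) | apply: is_subring0].
    rewrite horner_poly -[RHS](coef0 _ m) -Q0 coef_sum.
    by apply: eq_bigr => j _; rewrite coefZ mulrC.
  by move/(congr1 (coefp i)): r0; rewrite /= coef_poly ip coef0.
apply/polyP => i; rewrite coef0.
have [ip|/(nth_default 0)//] := ltnP i (size p).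
by rewrite (fP i).2 horner_coef big1 // => m _; rewrite f0 ?mul0r.
Qed.

(** Reversing the coefficients of [q] and scaling them by powers of [w] clears the denominators of
    [q.[w / x]]; [m] may exceed the degree. *)
Lemma horner_rev_poly (q : {poly F}) m w x : x != 0 -> (size q <= m.+1)%N ->
  (\poly_(i < m.+1) (q`_(m - i) * w ^+ (m - i))).[x] = x ^+ m * q.[w / x].
Proof.
move=> x0 qm; rewrite horner_poly (horner_coef_wide _ qm) mulr_sumr.
rewrite [RHS](reindex_inj rev_ord_inj) /=; apply: eq_bigr => i _.
have im : (i <= m)%N by rewrite -ltnS.
have -> : x ^+ m = x ^+ (m - i) * x ^+ i by rewrite -exprD subnK.
rewrite subSS expr_div_n (mulrA q`__ (w ^+ _)) [RHS]mulrC [RHS]mulrA.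
by rewrite divfK ?expf_neq0.
Qed.

(** Multiplied by a power of [x], a relation for [w / x] becomes one for [x]; its coefficients are
    those of [p] times powers of the nonzero [w]. *)
Lemma transcendental_div A x w : is_subfield A -> A w -> w != 0 ->
  transcendental A x -> transcendental A (w / x).
Proof.
move=> [As AV] Aw w0 Ax p Ap pwx0.
have x0 := transcendental_neq0 As Ax; set m := size p.
have q0 : \poly_(i < m.+1) (p`_(m - i) * w ^+ (m - i)) = 0.
  apply: Ax => [i|]; last by rewrite horner_rev_poly // pwx0 mulr0.
  rewrite coef_poly; case: ifP => _; last exact: is_subring0.
  by apply: is_subringM => //; apply: is_subringX.
apply/polyP => i; rewrite coef0.
have [im|/(nth_default 0)//] := ltnP i m.
move/(congr1 (coefp (m - i))): q0.
rewrite /= coef_poly coef0 ltnS leq_subr subKn 1?ltnW //.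
by move/eqP; rewrite mulf_eq0 expf_eq0 (negPf w0) andbF orbF => /eqP.
Qed.

End Subrings.

(** * Free families *)

Section FreeFamilies.
Variable F : fieldType.
Implicit Types (A B G R : set F).

Lemma subfield_genS A B : A `<=` B -> subfield_gen A `<=` subfield_gen B.
Proof.
move=> AB; apply: subfield_gen_min; first exact: subfield_gen_subfield.
exact: subset_trans AB (@mem_subfield_gen _ B).
Qed.

Definition other_field R n (x : 'I_n -> F) (k : 'I_n) : set F :=
  subfield_gen (R `|` x @` [set j | j != k]).

Lemma other_field_subring R n (x : 'I_n -> F) k :
  is_subring (other_field R x k).
Proof. exact: subfield_gen_subring. Qed.

Lemma other_field_base R n (x : 'I_n -> F) k : R `<=` other_field R x k.
Proof. by move=> r Rr; apply: mem_subfield_gen; left. Qed.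

Lemma other_field_var R n (x : 'I_n -> F) k j :
  j != k -> other_field R x k (x j).
Proof. by move=> jk; apply: mem_subfield_gen; right; exists j. Qed.

(* Equivalent to algebraic independence over the field generated by R, but
   stable under mutation and freezing without multivariate bookkeeping. *)
Definition free_family R n (x : 'I_n -> F) : Prop :=
  forall k, transcendental (other_field R x k) (x k).

Lemma free_family_neq0 R n (x : 'I_n -> F) k : free_family R x -> x k != 0.
Proof.
by move=> /(_ k); apply: transcendental_neq0; apply: other_field_subring.
Qed.

End FreeFamilies.

(** A relation for [x k] over the polynomials in the other variables lifts to a multivariate
    relation over the coefficient field; [transcendental_frac] then passes to quotients. *)
Lemma alg_independent_free (P : semifieldType) (F : fieldType)
    (iota : group_ring P -> F) n (x : 'I_n -> F) :
  alg_independent iota x -> free_family (range iota) x.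
Proof.
move=> xind k; set K := frac_field iota.
have Ks : is_subring K := @subfield_gen_subring _ _.
have over_K (g : mpoly n F) : (forall m, K g@_m) -> g \is a mpolyOver n (mem K).
  by move=> Kg; apply/allP => _ /mapP[m _ ->]; rewrite inE.
pose D : set F := [set c | exists g : mpoly n F,
  [/\ forall m, K g@_m, forall m, g@_m != 0 -> m k = 0%N & c = g.@[x]]].
have Ds : is_subring D.
  split.
  - exists 1; split; rewrite ?meval1 // => m; rewrite mcoeff1.
      by case: eqP => _; [apply: (is_subring1 Ks) | apply: (is_subring0 Ks)].
    by have [->|] := eqVneq m 0%MM; rewrite ?mnm0E ?eqxx.
  - move=> _ _ [g [Kg g0 ->]] [h [Kh h0 ->]].
    exists (g - h); split; rewrite ?mevalB // => m; rewrite mcoeffB.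
      exact: (is_subringB Ks).
    have [-> | /g0 //] := eqVneq g@_m 0.
    by rewrite sub0r oppr_eq0; apply: h0.
  - move=> _ _ [g [Kg g0 ->]] [h [Kh h0 ->]].
    exists (g * h); split; rewrite ?mevalM // => m.
      rewrite mcoeffM; apply: (is_subring_sum Ks) => i _.
      exact: (is_subringM Ks).
    rewrite mcoeff_eq0 negbK => /msuppM_le /allpairsP[[m1 m2] /= [Sm1 Sm2 ->]].
    by rewrite mnmDE g0 ?h0 // mcoeff_eq0 negbK.
have Dx : transcendental D (x k).
  move=> p Dp px0.
  have /choice [g gP] i := Dp i.
  (* No [g i] involves the variable [k], so the exponent of that variable separates the summands of
     [Q], and [Q = 0] forces each of these [g i] to vanish. *)
  pose Q : mpoly n F := \sum_(i < size p) g i * 'X_[U_(k) *+ i].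
  have coefgX i m : (g i * 'X_[U_(k) *+ i])@_m != 0 ->
      exists2 m', (g i)@_m' != 0 & m = (U_(k) *+ i + m')%MM.
    rewrite mcoeff_eq0 negbK (perm_mem (msuppMX _ _)) => /mapP[m' Sm' ->].
    by exists m'; rewrite // mcoeff_eq0 negbK.
  have Q0 : Q = 0.
    apply: xind.
      apply: over_K => m; rewrite raddf_sum.
      apply: (is_subring_sum Ks) => i _ /=.
      have [-> | /coefgX [m' _ ->]] := eqVneq (g i * 'X_[U_(k) *+ i])@_m 0.
        exact: (is_subring0 Ks).
      by rewrite mcoeffMX; case: (gP i).
    rewrite raddf_sum -[RHS]px0 horner_coef; apply: eq_bigr => i _ /=.
    case: (gP i) => _ _ ->; rewrite mevalM mevalX; congr (_ * _).
    rewrite (bigD1 k) //= mulmnE mnm1E eqxx mul1n big1 ?mulr1 // => j jk.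
    by rewrite mulmnE mnm1E eq_sym (negPf jk).
  apply/polyP => i; rewrite coef0.
  have [ip|/(nth_default 0)//] := ltnP i (size p).
  case: (gP i) => Kg g0 ->; suff -> : g i = 0 by rewrite meval0.
  apply/mpolyP => m; rewrite mcoeff0; apply/eqP.
  apply: contraT => gm0.
  have mk := g0 _ gm0; move/(congr1 (mcoeff (U_(k) *+ i + m)%MM)): Q0.
  rewrite raddf_sum mcoeff0 (bigD1 (Ordinal ip)) //= mcoeffMX big1 ?addr0.
    by move/eqP; rewrite (negPf gm0).
  move=> j ji; apply/eqP; apply: contraNT ji => /coefgX [m' gm' /mnmP /(_ k)].
  rewrite !mnmDE !mulmnE mnm1E eqxx !mul1n mk addn0.
  have [_ /(_ m' gm') -> _] := gP j.
  by rewrite addn0 => ij; apply/eqP/val_inj.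
apply: transcendentalS (transcendental_frac Ds Dx).
apply: subfield_genS => c [Rc | [j jk <-]].
  exists c%:MP; split; rewrite ?mevalC // => m; rewrite mcoeffC.
    case: eqP => _; rewrite ?mulr1 ?mulr0; last exact: (is_subring0 Ks).
    exact: mem_subfield_gen.
  by have [-> | _] := eqVneq m 0%MM; rewrite ?mnm0E ?mulr0 ?eqxx.
exists 'X_j; split; rewrite ?mevalXU // => m; rewrite mcoeffX.
  by case: eqP => _; [apply: (is_subring1 Ks) | apply: (is_subring0 Ks)].
by have [<- _ | _] := eqVneq U_(j)%MM m; rewrite ?eqxx ?mnm1E ?(negPf jk).
Qed.

(** * Coefficient maps and exchange matrices *)

Section CoefficientMaps.
Variables (P : semifieldType) (F : fieldType).
Implicit Types (iota : group_ring P -> F) (p q : P).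

(* What remains of an injective ring morphism in an iterated freezing. *)
Definition coefficient_map iota : Prop :=
  [/\ {morph iota : u v / u - v}, iota (gr_elt 1%g) = 1,
      forall p q, iota (gr_elt (p * q)%g) = iota (gr_elt p) * iota (gr_elt q)
    & forall p, iota (gr_elt p) + 1 != 0].

Lemma rmorphism_coefficient_map (iota : {rmorphism group_ring P -> F}) :
  injective iota -> coefficient_map iota.
Proof.
move=> inj; split=> [u v||p q|p]; first exact: rmorphB.
- by rewrite -[RHS](rmorph1 iota).
- rewrite -rmorphM; congr (iota _).
  by rewrite -[gr_elt _ * _]/(group_ring_mul _ _) group_ring_mulUU mulr1.
- rewrite -(rmorph1 iota) -rmorphD -(rmorph0 iota) (inj_eq inj).
  (* The coefficient at [p] is the integer 2 if [p] is the unit and 1 otherwise, hence nonzero. *)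
  apply/eqP => /(congr1 (monalg.mcoeff p)).
  have -> : monalg.mcoeff p (gr_elt p + 1) =
      monalg.mcoeff p (gr_elt p) + monalg.mcoeff p (gr_elt 1%g).
    exact: monalg.mcoeffD.
  by rewrite mcoeffUU mcoeffU monalg.mcoeff0; case: eqP.
Qed.

Section Fixed.
Variable iota : group_ring P -> F.
Hypothesis iotaP : coefficient_map iota.
Local Notation G p := (iota (gr_elt p)).

Lemma coefficient_map1 : G 1%g = 1. Proof. by case: iotaP. Qed.

Lemma coefficient_mapM p q : G (p * q)%g = G p * G q.
Proof. by case: iotaP. Qed.

Lemma coefficient_map_neq0 p : G p != 0.
Proof.
apply: contraTneq (oner_neq0 F) => p0.
by rewrite -coefficient_map1 -(mulgV p) coefficient_mapM p0 mul0r eqxx.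
Qed.

Lemma coefficient_mapV p : G (p^-1)%g = (G p)^-1.
Proof.
apply: (mulfI (coefficient_map_neq0 p)).
by rewrite -coefficient_mapM mulgV coefficient_map1 divff ?coefficient_map_neq0.
Qed.

Lemma coefficient_mapE u :
  iota u = \sum_(p <- monalg.msupp u) (monalg.mcoeff p u)%:~R * G p.
Proof.
have iotaB : {morph iota : u v / u - v} by case: iotaP.
pose f : {additive group_ring P -> F} :=
  HB.pack iota (GRing.isZmodMorphism.Build _ _ iota iotaB).
rewrite -[iota]/(f : _ -> _) {1}(monalgE u) raddf_sum; apply: eq_bigr => p _ /=.
rewrite mulrzl -[RHS](raddfMz f); congr (f _).
apply/malgP => q; rewrite mcoeffU.
have -> : monalg.mcoeff q (gr_elt p *~ monalg.mcoeff p u) =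
    monalg.mcoeff q (gr_elt p) *~ monalg.mcoeff p u by exact: raddfMz.
by rewrite mcoeffU; case: eqP => _; rewrite ?mulr1n ?mulr0n ?mul0rz // intz.
Qed.

Lemma coefficient_map_range (A : set F) :
  is_subring A -> (forall p, A (G p)) -> range iota `<=` A.
Proof.
move=> As GA _ [u _ <-]; rewrite coefficient_mapE.
apply: (is_subring_sum As) => p _; apply: (is_subringM As) => //.
exact: is_subring_int.
Qed.

End Fixed.
End CoefficientMaps.

Section ExchangeMatrices.
Variable n : nat.
Implicit Types B : 'M[int]_n.

Lemma pos_part_id (b : int) : 0 <= b -> pos_part b = b.
Proof. exact: max_l. Qed.

Lemma pos_part_eq0 (b : int) : b <= 0 -> pos_part b = 0.
Proof. exact: max_r. Qed.

Lemma pos_part_sub b : b = pos_part b - pos_part (- b).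
Proof.
case/orP: (le_total 0 b) => b0.
  by rewrite pos_part_id // pos_part_eq0 ?oppr_le0 // subr0.
by rewrite pos_part_eq0 // pos_part_id ?oppr_ge0 // opprK add0r.
Qed.

Lemma pos_part_add b : `|b| = pos_part b + pos_part (- b).
Proof.
case/orP: (le_total 0 b) => b0.
  by rewrite ger0_norm // pos_part_id // pos_part_eq0 ?oppr_le0 // addr0.
by rewrite ler0_norm // pos_part_eq0 // pos_part_id ?oppr_ge0 // add0r.
Qed.

Lemma mutation_term (a b : int) :
  ((`|a| * b + a * `|b|) %/ 2)%Z =
  pos_part a * pos_part b - pos_part (- a) * pos_part (- b).
Proof.
rewrite !pos_part_add [X in _ * X + _]pos_part_sub [X in _ + X * _]pos_part_sub.
move: (pos_part a) (pos_part (- a)) => a1 a2.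
move: (pos_part b) (pos_part (- b)) => b1 b2.
have -> : (a1 + a2) * (b1 - b2) + (a1 - a2) * (b1 + b2) =
    (a1 * b1 - a2 * b2) * 2.
  have -> : (a1 + a2) * (b1 - b2) = (a1 * b1 - a2 * b2) + (a2 * b1 - a1 * b2).
    rewrite mulrDl !mulrBr addrACA [RHS]addrACA.
    by rewrite [in RHS](addrC (- (a2 * b2))).
  have -> : (a1 - a2) * (b1 + b2) = (a1 * b1 - a2 * b2) - (a2 * b1 - a1 * b2).
    rewrite mulrBl !mulrDr !opprD !opprK addrACA [RHS]addrACA.
    by rewrite [in RHS](addrC (- (a2 * b2))).
  by rewrite addrACA subrr addr0 mulr_natr mulr2n.
by rewrite mulzK.
Qed.

Lemma skew_symmetrizableP B : skew_symmetrizable B <->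
  exists d : 'rV[rat]_n, (forall i, 0 < d 0 i) /\
    forall i j, d 0 i * (B i j)%:~R = - (d 0 j * (B j i)%:~R).
Proof.
split=> -[d [d0 dB]]; exists d; split=> //.
  by move=> i j; move/matrixP/(_ j i): dB; rewrite mul_diag_mx !mxE.
by apply/matrixP => i j; rewrite mul_diag_mx !mxE dB.
Qed.

Lemma skew_symmetrizable_sign B i j :
  skew_symmetrizable B -> (0 < B i j) = (B j i < 0).
Proof.
move=> /skew_symmetrizableP[d [d0 /(_ i j) dB]].
rewrite -(ltr0z rat) -(ltrz0 rat) -(pmulr_rgt0 _ (d0 i)) dB.
by rewrite oppr_gt0 pmulr_rlt0.
Qed.

Lemma skew_symmetrizable_diag B i : skew_symmetrizable B -> B i i = 0.
Proof.
move=> Bs; have := skew_symmetrizable_sign i i Bs.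
by case: ltgtP.
Qed.

End ExchangeMatrices.

Lemma skew_symmetrizable_mxsub n (B : 'M[int]_n) m (f : 'I_m -> 'I_n) :
  skew_symmetrizable B -> skew_symmetrizable (\matrix_(i, j) B (f i) (f j)).
Proof.
move=> /skew_symmetrizableP[d [d0 dB]]; apply/skew_symmetrizableP.
exists (\row_i d 0 (f i)); split=> [i|i j]; first by rewrite mxE.
by rewrite !mxE dB.
Qed.

(** The symmetrizer [d] still works: scaled by it, the first product of [mutation_term] at [(i, j)]
    equals the second one at [(j, i)]. *)
Lemma skew_symmetrizable_mutate n (B : 'M[int]_n) k :
  skew_symmetrizable B -> skew_symmetrizable (mutate_exchange B k).
Proof.
move=> /skew_symmetrizableP[d [d0 dB]]; apply/skew_symmetrizableP.
exists d; split=> // i j; rewrite !mxE orbC.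
case: ifP => _; first by rewrite !rmorphN !mulrN dB.
(* Taking positive parts commutes with scaling by the positive entries of [d]. *)
have dpos i1 i2 : d 0 i1 * (pos_part (B i1 i2))%:~R =
    d 0 i2 * (pos_part (- B i2 i1))%:~R.
  have mono (z : int) : (pos_part z)%:~R = Num.max (z%:~R) 0 :> rat.
    rewrite /pos_part; case/orP: (le_total 0 z) => z0.
      by rewrite !max_l // ler0z.
    by rewrite !max_r // lerz0.
  by rewrite !mono !maxr_pMr ?(ltW (d0 _)) // !mulr0 dB rmorphN mulrN.
have dneg i1 i2 : d 0 i1 * (pos_part (- B i1 i2))%:~R =
    d 0 i2 * (pos_part (B i2 i1))%:~R by rewrite dpos.
rewrite !mutation_term !rmorphD !rmorphN !rmorphM /= !mulrDr !mulrN dB.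
rewrite opprD opprB; congr (_ + (_ - _)); rewrite !mulrA.
  by rewrite (dpos i k) mulrAC (dpos k j).
by rewrite (dneg i k) mulrAC (dneg k j).
Qed.

(** * Mutation of free clusters *)

Section FreeMutation.
Variable F : fieldType.
Implicit Types R : set F.

(** For [k] this is [transcendental_div]. For another [j], let [L] be generated by [R] and the
    variables other than [j] and [k]: as [x' k] is transcendental over [L[x j]],
    [transcendental_exchange] makes [x j] transcendental over [L[x' k]], and then over its
    fractions. *)
Lemma free_family_exchange R n (x x' : 'I_n -> F) k w :
  free_family R x -> other_field R x k w -> w != 0 ->
  x' k = w / x k -> (forall j, j != k -> x' j = x j) -> free_family R x'.
Proof.
move=> xfree Kw w0 x'k x'j.
have sub_k : other_field R x' k `<=` other_field R x k.
  apply: subfield_genS => z [Rz | [j jk <-]]; first by left.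
  by right; exists j; rewrite ?x'j.
have bk : transcendental (other_field R x k) (x' k).
  by rewrite x'k; apply: transcendental_div => //; apply: subfield_gen_subfield.
move=> j; have [-> | jk] := eqVneq j k; first exact: transcendentalS bk.
pose L := subfield_gen (R `|` x @` [set i | i != j /\ i != k]).
have Lj : L `<=` other_field R x j.
  apply: subfield_genS => z [Rz | [i [ij _] <-]]; first by left.
  by right; exists i.
have Ls : is_subring L := @subfield_gen_subring _ _.
rewrite x'j //.
have ab : transcendental (subring_gen (L `|` [set x' k])) (x j).
  apply: (transcendental_exchange Ls); first exact: transcendentalS (xfree j).
  apply: transcendentalS bk; apply: subring_gen_min.
    exact: other_field_subring.
  move=> z [Lz | ->]; last exact: other_field_var.
  move: z Lz; apply: subfield_genS => z [Rz | [i [_ ik] <-]]; first by left.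
  by right; exists i.
have Ss := @subring_gen_subring _ (L `|` [set x' k]).
apply: transcendentalS (transcendental_frac Ss ab).
apply: subfield_genS => z [Rz | [i ij <-]]; apply: mem_subring_gen.
  by left; apply: mem_subfield_gen; left.
have [-> | ik] := eqVneq i k; [by right | left].
by rewrite x'j //; apply: mem_subfield_gen; right; exists i.
Qed.

Lemma other_field_monomial R n (x : 'I_n -> F) k (Q : pred 'I_n)
    (e : 'I_n -> int) :
  (forall j, Q j -> j != k) -> other_field R x k (\prod_(j | Q j) x j ^ e j).
Proof.
move=> Qk; apply: (is_subring_prod (other_field_subring R x k)) => j /Qk jk.
apply: (is_subringXz (other_field_subring R x k)).
  exact: other_field_var.
by move=> _; apply: subfield_genV; apply: other_field_var.
Qed.

(** Dividing by [g] and by the part of the first monomial free of [x k] leaves [x k ^+ m] plus an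
    element of the field of the other variables. *)
Lemma free_binomial_neq0 R n (x : 'I_n -> F) k (m : nat)
    (e f : 'I_n -> int) g h :
  free_family R x -> R g -> R h -> g != 0 -> (0 < m)%N -> e k = m -> f k = 0 ->
  g * \prod_j x j ^ e j + h * \prod_j x j ^ f j != 0.
Proof.
move=> xfree Rg Rh g0 m0 ek fk.
rewrite (bigD1 k) //= [X in _ + h * X](bigD1 k) //= ek fk expr0z mul1r.
set M := \prod_(_ | _) _; set N := \prod_(_ | _) _.
have Ks := other_field_subring R x k.
have KM : other_field R x k (g * M).
  apply: (is_subringM Ks); first exact: other_field_base.
  exact: other_field_monomial.
have M0 : g * M != 0.
  rewrite mulf_neq0 // prodf_seq_neq0; apply/allP => j _; apply/implyP => _.
  by rewrite expfz_neq0 ?(free_family_neq0 _ xfree).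
have -> : g * (x k ^ m%:Z * M) + h * N = g * M * (x k ^+ m + h * N / (g * M)).
  by rewrite mulrDr [in RHS]mulrC mulrCA mulrC [in RHS]mulrCA divff // mulr1.
rewrite mulf_neq0 //; apply: (transcendental_monomial Ks (xfree k)) => //.
apply: (is_subringM Ks); last exact: subfield_genV.
apply: (is_subringM Ks); first exact: other_field_base.
exact: other_field_monomial.
Qed.

End FreeMutation.

Section Invariance.
Variables (P : semifieldType) (F : fieldType).

Definition regular_seed (iota : group_ring P -> F) n (s : seed P F n) : Prop :=
  [/\ coefficient_map iota, free_family (range iota) (cluster s)
    & skew_symmetrizable (exchange s)].

Variables (iota : group_ring P -> F) (n : nat).
Implicit Types s t : seed P F n.
Local Notation G p := (iota (gr_elt p)).

(** If column [k] has a nonzero entry in row [j], only one of the two monomials involves [x j]. If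
    the column is zero, the numerator is [G y + 1], nonzero by the last clause of
    [coefficient_map]. *)
Lemma exchange_numerator_neq0 s k : regular_seed iota s ->
  G (coeffs s k) * \prod_j cluster s j ^ pos_part (exchange s j k)
    + \prod_j cluster s j ^ pos_part (- exchange s j k) != 0.
Proof.
case=> iotaP xfree Bs; set B := exchange s; set y := coeffs s k.
have RG p : range iota (G p) by exists (gr_elt p).
(* The second monomial receives the coefficient [G 1], so that both coefficients in
   [free_binomial_neq0] come from the range of [iota]. *)
rewrite -[X in _ + X]mul1r -{2}(coefficient_map1 iotaP).
have [[j Bjk] | Bk0] := pselect (exists j, B j k != 0); last first.
  have Bk j : B j k = 0.
    by apply/eqP; apply: contrapT => /negP Bjk; apply: Bk0; exists j.
  rewrite !big1 ?mulr1 ?coefficient_map1 //; first by case: iotaP.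
    by move=> j _; rewrite Bk /pos_part oppr0 maxxx expr0z.
  by move=> j _; rewrite Bk /pos_part maxxx expr0z.
have G0 := coefficient_map_neq0 iotaP.
case/orP: (le_total 0 (B j k)) => Bjk0.
  apply: (@free_binomial_neq0 _ _ _ _ j `|B j k|%N _ _ _ _ xfree) => //.
  - by rewrite absz_gt0.
  - by rewrite pos_part_id // gez0_abs.
  - by rewrite pos_part_eq0 ?oppr_le0.
rewrite addrC.
apply: (@free_binomial_neq0 _ _ _ _ j `|B j k|%N _ _ _ _ xfree) => //.
- by rewrite absz_gt0.
- by rewrite pos_part_id ?oppr_ge0 // lez0_abs.
- by rewrite pos_part_eq0.
Qed.

Lemma mutate_regular s k :
  regular_seed iota s -> regular_seed iota (mutate iota s k).
Proof.
move=> sreg; case: (sreg) => iotaP xfree Bs.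
split=> //; last exact: skew_symmetrizable_mutate.
set N := G (coeffs s k) * \prod_j cluster s j ^ pos_part (exchange s j k)
  + \prod_j cluster s j ^ pos_part (- exchange s j k).
have Ks := other_field_subring (range iota) (cluster s) k.
have KG p : other_field (range iota) (cluster s) k (G p).
  by apply: other_field_base; exists (gr_elt p).
apply: (@free_family_exchange _ _ _ (cluster s) _ k
    (N / G (oplus (coeffs s k) 1%g))) => //.
- apply: (is_subringM Ks); last by apply: subfield_genV; apply: KG.
  (* The diagonal entry at [k] is 0, so the numerator does not involve [x k]. *)
  rewrite /N (bigD1 k) //= [X in _ + X](bigD1 k) //= skew_symmetrizable_diag //.
  rewrite /pos_part oppr0 maxxx expr0z !mul1r.
  apply: (is_subringD Ks); last exact: other_field_monomial.
  by apply: (is_subringM Ks) => //; apply: other_field_monomial.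
- rewrite mulf_neq0 ?invr_eq0 ?coefficient_map_neq0 //.
  exact: exchange_numerator_neq0.
- by rewrite ffunE eqxx invfM mulrA.
- by move=> j jk; rewrite ffunE (negPf jk).
Qed.

Lemma permute_regular s w :
  regular_seed iota s -> regular_seed iota (permute s w).
Proof.
case=> iotaP xfree Bs; split=> //; last exact: skew_symmetrizable_mxsub.
move=> k; rewrite ffunE; apply: transcendentalS (xfree (w k)).
apply: subfield_genS => z [Rz | [j jk <-]]; [by left | right].
by rewrite ffunE; exists (w j); rewrite //= (inj_eq perm_inj).
Qed.

Lemma mutation_equivalent_regular s t :
  mutation_equivalent iota s t -> regular_seed iota s -> regular_seed iota t.
Proof.
by elim=> // {}t k _ IHt /IHt; [apply: mutate_regular | apply: permute_regular].
Qed.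

Lemma mutation_equivalent_trans s t u :
  mutation_equivalent iota s t -> mutation_equivalent iota t u ->
  mutation_equivalent iota s u.
Proof.
by move=> st; elim=> // v k _; [apply: MutMutate | apply: MutPermute].
Qed.

Lemma cluster_algebra_equivalent s t : mutation_equivalent iota s t ->
  cluster_algebra iota t `<=` cluster_algebra iota s.
Proof.
move=> st; apply: subring_genS => z [Rz | [u tu uz]]; first by left.
by right; exists u => //; apply: mutation_equivalent_trans tu.
Qed.

Lemma upper_cluster_algebra_equivalent s t : mutation_equivalent iota s t ->
  upper_cluster_algebra iota s `<=` upper_cluster_algebra iota t.
Proof.
by move=> st z Uz u tu; apply: Uz; apply: mutation_equivalent_trans tu.
Qed.

Lemma cluster_algebra_subring s : is_subring (cluster_algebra iota s).
Proof. exact: subring_gen_subring. Qed.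

Lemma cluster_algebra_base s : range iota `<=` cluster_algebra iota s.
Proof. by move=> r Rr; apply: mem_subring_gen; left. Qed.

Lemma cluster_algebra_var s t j : mutation_equivalent iota s t ->
  cluster_algebra iota s (cluster t j).
Proof.
by move=> st; apply: mem_subring_gen; right; exists t => //; exists j.
Qed.

End Invariance.

(** * Freezing *)

Section Freezing.
Variables (P : semifieldType) (F : fieldType).
Implicit Types (p : P) (a z : int).
Local Notation Pf := (frozen_semifield P).

Lemma frozen_expgz p a z :
  expgz ((p, a) : Pf) z = (expgz p z, a * z) :> Pf.
Proof.
case: z => m; rewrite /expgz frozen_expgE; first by rewrite -mulr_natr natz.
rewrite NegzE mulrN -[m.+1%:Z]natz mulr_natr.
by [].
Qed.

Section Seeds.
Variable iota : group_ring P -> F.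
Local Notation G p := (iota (gr_elt p)).

Lemma freeze_iota_elt x (u : Pf) :
  freeze_iota iota x (gr_elt u) = G u.1 * x ^ u.2.
Proof. by rewrite /freeze_iota /gr_elt mmapU mul1r. Qed.

Variable n : nat.
Implicit Types (s t : seed P F n) (i : 'I_n).
Local Notation fiota s i := (freeze_iota iota (cluster s i)).

Lemma freeze_coefficient_map s i :
  regular_seed iota s -> coefficient_map (fiota s i).
Proof.
case=> iotaP xfree _; have x0 := free_family_neq0 i xfree; split.
- by move=> u v; rewrite /freeze_iota monalg.mmapB.
- by rewrite freeze_iota_elt coefficient_map1 // mulr1.
- move=> [p a] [q b]; rewrite 3!freeze_iota_elt /= (coefficient_mapM iotaP).
  by rewrite expfzDr // mulrACA.
move=> [p [m|m]]; rewrite freeze_iota_elt /=.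
- have [-> | m0] := posnP m; first by rewrite expr0z mulr1; case: iotaP.
  have -> : G p * cluster s i ^ m + 1 = G p * (cluster s i ^+ m + G (p^-1)%g).
    by rewrite mulrDr -coefficient_mapM // mulgV coefficient_map1.
  rewrite mulf_neq0 ?coefficient_map_neq0 //.
  apply: (transcendental_monomial (other_field_subring _ _ _) (xfree i)) => //.
  by apply: other_field_base; exists (gr_elt (p^-1)%g).
have -> : G p * cluster s i ^ Negz m + 1 =
    (cluster s i ^+ m.+1 + G p) * cluster s i ^ Negz m.
  by rewrite mulrDl NegzE -exprnN divff ?expf_neq0 // addrC.
rewrite mulf_neq0 ?expfz_neq0 //.
apply: (transcendental_monomial (other_field_subring _ _ _) (xfree i)) => //.
by apply: other_field_base; exists (gr_elt p).
Qed.

Lemma freeze_range (A : set F) s i : regular_seed iota s -> is_subring A ->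
  range iota `<=` A -> A (cluster s i) -> A (cluster s i)^-1 ->
  range (fiota s i) `<=` A.
Proof.
move=> sreg As RA Ax AVx.
apply: (coefficient_map_range (freeze_coefficient_map i sreg) As) => u.
rewrite freeze_iota_elt; apply: (is_subringM As); last exact: is_subringXz.
by apply: RA; exists (gr_elt u.1).
Qed.

Lemma freeze_regular s i :
  regular_seed iota s -> regular_seed (fiota s i) (freeze_seed s i).
Proof.
move=> sreg; case: (sreg) => iotaP xfree Bs; split.
- exact: freeze_coefficient_map.
- move=> k; rewrite ffunE; apply: transcendentalS (xfree (lift i k)).
  have Ks := other_field_subring (range iota) (cluster s) (lift i k).
  have Kx : other_field (range iota) (cluster s) (lift i k) (cluster s i).
    by apply: other_field_var; apply: neq_lift.
  apply: subfield_gen_min; first exact: subfield_gen_subfield.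
  move=> z [ | [j jk <-]].
    apply: freeze_range => //; first exact: other_field_base.
    by apply: subfield_genV; apply: Kx.
  by rewrite ffunE; apply: other_field_var; rewrite (inj_eq lift_inj).
- have -> : exchange (freeze_seed s i) =
      \matrix_(j, k) exchange s (lift i j) (lift i k).
    by apply/matrixP => j k; rewrite !mxE.
  exact: skew_symmetrizable_mxsub.
Qed.

Lemma freeze_mutate s i (k : 'I_n.-1) : regular_seed iota s ->
  freeze_seed (mutate iota s (lift i k)) i =
  mutate (fiota s i) (freeze_seed s i) k.
Proof.
case=> iotaP xfree _; have x0 := free_family_neq0 i xfree.
set B := exchange s.
have -> : mutate (fiota s i) (freeze_seed s i) k =
  Seed (mutate_cluster (fiota s i) (freeze_seed s i) k)
    (mutate_coeffs (freeze_seed s i) k)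
    (mutate_exchange (exchange (freeze_seed s i)) k) by [].
congr Seed.
- apply/ffunP => j; rewrite !ffunE /= (inj_eq lift_inj).
  case: ifP => // _; set b := B i (lift i k).
  rewrite !(bigD1_ord i) //= -/B -/b !freeze_iota_elt /=.
  have prodE (g : int -> int) :
      \prod_(l < n.-1) [ffun l => cluster s (lift i l)] l
        ^ g (row' i (col' i B) l k) =
      \prod_(l < n.-1) cluster s (lift i l) ^ g (B (lift i l) (lift i k)).
    by apply: eq_bigr => l _; rewrite ffunE !mxE.
  rewrite (prodE pos_part) (prodE (fun b => pos_part (- b))).
  set M := \prod_(_ < _) _; set N := \prod_(_ < _) _.
  have -> : Num.min b 0 = - pos_part (- b).
    by rewrite /pos_part oppr_max opprK oppr0.
  set A := G (coeffs s _); set o := G (oplus _ _).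
  set X := cluster s (lift i k).
  have -> : o * cluster s i ^ (- pos_part (- b)) * X =
      o * X / cluster s i ^ pos_part (- b) by rewrite mulrAC invr_expz.
  rewrite invf_div [in RHS]mulrA; congr (_ / _).
  rewrite mulrDl [N * _]mulrC; congr (_ + _).
  have -> : cluster s i ^ pos_part b =
      cluster s i ^ b * cluster s i ^ pos_part (- b).
    by rewrite -expfzDr // {2}(pos_part_sub b) subrK.
  by rewrite [in RHS]mulrAC -!mulrA; congr (_ * _); rewrite mulrCA.
- apply/ffunP => j; rewrite !ffunE (inj_eq lift_inj).
  case: ifP => jk; rewrite !mxE ?eqxx ?orbT /=.
    by rewrite (eqP jk) eqxx orbT.
  rewrite !frozen_expgz; congr pair; rewrite (negPf (neq_lift i k)) -/B.
  rewrite mutation_term (inj_eq lift_inj) jk /= -addrA; congr (_ + _).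
  move: (B i (lift i k)) (B (lift i k) (lift i j)) => b c.
  have -> : Num.min b 0 = - pos_part (- b).
    by rewrite /pos_part oppr_max opprK oppr0.
  rewrite mulrNN {3}(pos_part_sub b) {4}(pos_part_sub c) mulrBl mulrBr.
  by rewrite addrA subrK.
- apply/(@matrixP int n.-1 n.-1) => j l.
by rewrite !mxE !(inj_eq lift_inj).
Qed.

End Seeds.

Lemma freeze_permute n (s : seed P F n.+1) i (w : 'S_n) :
  freeze_seed (permute s (lift_perm i i w)) i = permute (freeze_seed s i) w.
Proof.
rewrite /freeze_seed /permute /=; congr Seed.
- by apply/ffunP => j; rewrite !ffunE lift_perm_lift.
- by apply/ffunP => j; rewrite !ffunE !mxE lift_perm_id lift_perm_lift.
- by apply/matrixP => j k; rewrite !mxE !lift_perm_lift.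
Qed.

Section FrozenAlgebras.
Variables (iota : group_ring P -> F) (n : nat).
Implicit Types (s t : seed P F n) (i : 'I_n).
Local Notation fiota s i := (freeze_iota iota (cluster s i)).

Lemma freeze_mutation_equivalent s i u : regular_seed iota s ->
  mutation_equivalent (fiota s i) (freeze_seed s i) u ->
  exists2 t, mutation_equivalent iota s t &
    u = freeze_seed t i /\ cluster t i = cluster s i.
Proof.
move=> sreg; elim=> [|{}u k _ [t st [-> ti]] | {}u w _ [t st [-> ti]]].
- by exists s => //; apply: MutRefl.
- exists (mutate iota t (lift i k)); first exact: MutMutate.
  rewrite freeze_mutate ?ti; last exact: mutation_equivalent_regular sreg.
  by split=> //; rewrite -ti ffunE (negPf (neq_lift i k)).
- case: n s i t w sreg st ti => [s [] //|m] s i t w sreg st ti.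
  exists (permute t (lift_perm i i w)); first exact: MutPermute.
  by rewrite freeze_permute; split=> //; rewrite ffunE lift_perm_id.
Qed.

Lemma upper_cluster_algebra_freeze s i : regular_seed iota s ->
  upper_cluster_algebra iota s `<=`
  upper_cluster_algebra (fiota s i) (freeze_seed s i).
Proof.
move=> sreg z Uz u /= /(freeze_mutation_equivalent sreg) [t st [-> ti]].
have treg := mutation_equivalent_regular st sreg.
case: (treg) => iotaP xfree _.
move: z {Uz} (Uz t st); apply: subring_gen_min.
  exact: subring_gen_subring.
have Ls := @subring_gen_subring _ (range (fiota s i)
  `|` range (cluster (freeze_seed t i))
  `|` range (fun j => (cluster (freeze_seed t i) j)^-1)).
have fin (v : Pf) : laurent_ring (fiota s i) (cluster (freeze_seed t i))
    (iota (gr_elt v.1) * cluster t i ^ v.2).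
  apply: mem_subring_gen; left; left; exists (gr_elt v) => //.
  by rewrite freeze_iota_elt ti.
move=> z [[Rz | [j _ <-]] | [j _ <-]].
- move: z Rz; apply: (coefficient_map_range iotaP Ls) => p.
  by have := fin (p, 0); rewrite expr0z mulr1.
- case: (unliftP i j) => [l -> | ->].
    by apply: mem_subring_gen; left; right; exists l; rewrite // ffunE.
  by have := fin (1%g, 1); rewrite coefficient_map1 // mul1r expr1z.
- case: (unliftP i j) => [l -> | ->].
    by apply: mem_subring_gen; right; exists l; rewrite // ffunE.
  by have := fin (1%g, -1); rewrite coefficient_map1 // mul1r exprN1.
Qed.

Lemma cluster_algebra_freeze s i : regular_seed iota s ->
  cluster_algebra (fiota s i) (freeze_seed s i) `<=`
  subring_gen (cluster_algebra iota s `|` [set (cluster s i)^-1]).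
Proof.
move=> sreg.
have As := @subring_gen_subring _
  (cluster_algebra iota s `|` [set (cluster s i)^-1]).
apply: (subring_gen_min As) => c [ | [u su [j _ <-]]].
  apply: (freeze_range sreg As).
  - by move=> r Rr; apply: mem_subring_gen; left; apply: cluster_algebra_base.
  - apply: mem_subring_gen; left; apply: cluster_algebra_var.
    exact: MutRefl.
  - by apply: mem_subring_gen; right.
have [t st [-> _]] := freeze_mutation_equivalent sreg su.
by apply: mem_subring_gen; left; rewrite ffunE; apply: cluster_algebra_var.
Qed.

End FrozenAlgebras.
End Freezing.

(** * Isolated seeds *)

Section OneVariable.
Variable F : fieldType.
Implicit Types (A : set F) (x w u : F).

Lemma laurent_quotient A x u : is_subring A -> x != 0 ->
  subring_gen (A `|` ([set x] `|` [set x^-1])) u ->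
  exists (p : {poly F}) (m : nat), (forall i, A p`_i) /\ u = p.[x] / x ^+ m.
Proof.
move=> As x0; move: u; apply: subring_gen_min.
  split=> [|_ _ [p [m [Ap ->]]] [q [l [Aq ->]]]
           |_ _ [p [m [Ap ->]]] [q [l [Aq ->]]]].
  - exists 1, 0%N; split; last by rewrite hornerC divr1.
    move=> i; rewrite coef1; case: eqP => _; last exact: is_subring0.
    exact: is_subring1.
  - exists (p * 'X^l - q * 'X^m), (m + l)%N; split=> [i|].
      rewrite coefB !coefMXn; apply: is_subringB => //; case: ifP => // _;
        exact: is_subring0.
    rewrite -mulNr addf_div ?expf_neq0 // !hornerE -exprD.
    by rewrite mulNr.
  - exists (p * q), (m + l)%N; split=> [i|]; last first.
      by rewrite mulf_div hornerM exprD.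
    by rewrite coefM; apply: is_subring_sum => // j _; apply: is_subringM.
move=> u [Au | [-> | ->]].
- exists u%:P, 0%N; split; last by rewrite hornerC divr1.
  by move=> i; rewrite coefC; case: eqP => // _; apply: is_subring0.
- exists 'X, 0%N; split; last by rewrite hornerX divr1.
  move=> i; rewrite coefX; case: eqP => _; last exact: is_subring0.
  exact: is_subring1.
- exists 1, 1%N; split; last by rewrite hornerC mul1r.
  move=> i; rewrite coef1; case: eqP => _; last exact: is_subring0.
  exact: is_subring1.
Qed.

(** Write [u] as [p.[x] / x ^+ m] and as [q.[w / x] / (w / x) ^+ l]. Comparison shows that
    [w ^+ (m - i)] divides the coefficient of [p] in each degree [i < m], so every negative power of
    [x] comes with a matching power of [w]. *)
Lemma laurent_intersection A x w u :
  is_subring A -> transcendental A x -> A w -> w != 0 ->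
  subring_gen (A `|` ([set x] `|` [set x^-1])) u ->
  subring_gen (A `|` ([set w / x] `|` [set (w / x)^-1])) u ->
  subring_gen (A `|` ([set x] `|` [set w / x])) u.
Proof.
move=> As Ax Aw w0; have x0 := transcendental_neq0 As Ax.
have wx0 : w / x != 0 by rewrite mulf_neq0 ?invr_eq0.
move=> /(laurent_quotient As x0) [p [m [Ap up]]].
move=> /(laurent_quotient As wx0) [q [l [Aq uq]]].
(* Multiplication by [x ^+ T] clears the denominators of both expressions; the summand [D] ensures
   that [T] is at least the degree of [q]. *)
pose D := size q; pose T := (m + l + D)%N.
pose r := \poly_(i < T.+1) (q`_(T - i) * w ^+ (T - i)).
have pq : r = w ^+ l *: (p * 'X^D).
  apply/eqP; rewrite -subr_eq0; apply/eqP; apply: Ax => [i|].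
    rewrite coefB coefZ coefMXn coef_poly; apply: (is_subringB As).
      case: ifP => _; last exact: is_subring0.
      by apply: is_subringM => //; apply: is_subringX.
    apply: is_subringM => //; first exact: is_subringX.
    by case: ifP => // _; apply: is_subring0.
  have sq : (size q <= T.+1)%N by rewrite ltnW // ltnS leq_addl.
  rewrite hornerD hornerN horner_rev_poly // hornerZ hornerM hornerXn.
  have -> : q.[w / x] = u * (w / x) ^+ l by rewrite uq divfK ?expf_neq0.
  rewrite up expr_div_n mulf_div -exprD /T exprD mulrAC.
  rewrite [x ^+ _ * _]mulrC divfK ?expf_neq0 //.
  by rewrite mulrA [w ^+ l * p.[x]]mulrC subrr.
have Ss := @subring_gen_subring _ (A `|` ([set x] `|` [set w / x])).
have SA a : A a -> subring_gen (A `|` ([set x] `|` [set w / x])) a.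
  by move=> Aa; apply: mem_subring_gen; left.
rewrite up horner_coef mulr_suml; apply: (is_subring_sum Ss) => i _.
have [im | mi] := leqP m i.
  rewrite -mulrA -expfB_cond ?(negPf x0) //.
  apply: (is_subringM Ss); first exact: SA.
  by apply: (is_subringX Ss); apply: mem_subring_gen; right; left.
(* This is [pq] in degree [i + D], after cancelling [w ^+ l]. *)
have -> : p`_i = q`_(m + l - i) * w ^+ (m - i).
  have iT : (i + D < T.+1)%N.
    by rewrite ltnS leq_add2r ltnW // (leq_trans mi) ?leq_addr.
  apply: (mulIf (expf_neq0 l w0)); move/(congr1 (coefp (i + D))): pq.
  rewrite /= coef_poly iT coefZ coefMXn ltnNge leq_addl /= addnK => pqi.
  rewrite [LHS]mulrC -pqi subnDr -mulrA -exprD; congr (_ * _ ^+ _).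
  by rewrite addnBAC // ltnW.
have -> : q`_(m + l - i) * w ^+ (m - i) * x ^+ i / x ^+ m =
    q`_(m + l - i) * (w / x) ^+ (m - i).
  rewrite -!mulrA; congr (_ * _); rewrite expr_div_n; congr (_ * _).
  have -> : x ^+ m = x ^+ (m - i) * x ^+ i by rewrite -exprD subnK // ltnW.
  by rewrite invfM mulrCA divff ?mulr1 ?expf_neq0.
apply: (is_subringM Ss); first exact: SA.
by apply: (is_subringX Ss); apply: mem_subring_gen; right; right.
Qed.

End OneVariable.

Section Isolated.
Variables (P : semifieldType) (F : fieldType) (iota : group_ring P -> F).
Variables (n : nat) (s : seed P F n).
Hypothesis sreg : regular_seed iota s.
Hypothesis B0 : exchange s = 0.
Local Notation G p := (iota (gr_elt p)).
Local Notation x := (cluster s).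
Local Notation y := (coeffs s).
Implicit Types (i j k : 'I_n) (o : option bool) (u : F).

(** With a zero exchange matrix, [w j] is the product of [x j] and its mutation. *)
Let w j : F := (G (y j) + 1) / G (oplus (y j) 1%g).

(** As the matrix stays zero, mutation at [k] leaves the other coefficients and variables alone; by
    [uniq] each index is mutated once, with its initial coefficient. *)
Lemma isolated_equivalent (l : seq 'I_n) : uniq l ->
  exists t, [/\ mutation_equivalent iota s t, exchange t = 0,
    forall j, j \notin l -> coeffs t j = y j
    & forall j, cluster t j = if j \in l then w j / x j else x j].
Proof.
elim: l => [_|k l IHl /= /andP[kl /IHl [t [st Bt yt xt]]]].
  by exists s; split=> //; apply: MutRefl.
exists (mutate iota t k); split.
- exact: MutMutate.
- apply/matrixP => i j; rewrite !mxE Bt !mxE oppr0 normr0 !mul0r addr0.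
  by rewrite if_same.
- move=> j; rewrite inE negb_or => /andP[jk jl]; rewrite ffunE (negPf jk) Bt.
  by rewrite mxE /pos_part oppr0 maxxx /expgz /= !expg0 !mulg1 yt.
- move=> j; rewrite ffunE inE.
  have [-> /= | jk /=] := eqVneq j k; last exact: xt.
  rewrite !big1 ?mulr1; first by rewrite yt // xt (negPf kl) /w invfM mulrA.
    by move=> i _; rewrite Bt mxE /pos_part oppr0 maxxx expr0z.
  by move=> i _; rewrite Bt mxE /pos_part maxxx expr0z.
Qed.

(* None stands for a variable together with its mutation, Some false for the
   variable and its inverse, Some true for the mutated variable and its
   inverse. *)
Definition local_generators o j : set F :=
  match o with
  | None => [set x j] `|` [set w j / x j]
  | Some false => [set x j] `|` [set (x j)^-1]
  | Some true => [set w j / x j] `|` [set (w j / x j)^-1]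
  end.

Definition mixed_ring (sigma : 'I_n -> option bool) : set F :=
  subring_gen (range iota `|`
    [set z | exists j, local_generators (sigma j) j z]).

(** Without [None] the mixed ring is the Laurent ring of the cluster obtained by mutating at every
    [j] with [f j]. *)
Lemma upper_mixed_ring_total (f : 'I_n -> bool) :
  upper_cluster_algebra iota s `<=` mixed_ring (fun j => Some (f j)).
Proof.
move=> u Uu; have [t [st _ _ xt]] := isolated_equivalent (enum_uniq f).
have {}xt j : cluster t j = if f j then w j / x j else x j.
  by rewrite xt mem_enum.
move: {Uu} u (Uu t st); apply: subring_genS => z [[Rz | [j _ <-]] | [j _ <-]].
- by left.
- by right; exists j; rewrite xt; case: (f j); left.
- by right; exists j; rewrite xt; case: (f j); right.
Qed.

Lemma w_neq0 j : w j != 0.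
Proof.
case: sreg => iotaP _ _; rewrite mulf_neq0 //; first by case: iotaP.
by rewrite invr_eq0 coefficient_map_neq0.
Qed.

(** This is [laurent_intersection] for [x k] over the ring [A] of the coefficients and the local
    generators at the other indices, which lies in the field of the other variables. *)
Lemma mixed_ring_glue (sigma : 'I_n -> option bool) k u : sigma k = None ->
  (forall b, mixed_ring (fun j => if j == k then Some b else sigma j) u) ->
  mixed_ring sigma u.
Proof.
case: sreg => iotaP xfree _ sk Hu.
pose A := subring_gen (range iota `|`
  [set z | exists2 j, j != k & local_generators (sigma j) j z]).
have As : is_subring A := @subring_gen_subring _ _.
have GA p : A (G p) by apply: mem_subring_gen; left; exists (gr_elt p).
have wA : A (w k).
  rewrite /w -coefficient_mapV //; apply: (is_subringM As) => //.
  by apply: (is_subringD As) => //; apply: (is_subring1 As).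
have Ax : transcendental A (x k).
  apply: transcendentalS (xfree k); apply: subring_gen_min.
    exact: other_field_subring.
  have Ks := other_field_subring (range iota) x k.
  move=> z [Rz | [j jk]]; first exact: other_field_base.
  have Kx : other_field (range iota) x k (x j) by apply: other_field_var.
  have KVx : other_field (range iota) x k (x j)^-1 by apply: subfield_genV.
  have KG p : other_field (range iota) x k (G p).
    by apply: other_field_base; exists (gr_elt p).
  have Kwx : other_field (range iota) x k (w j / x j).
    apply: (is_subringM Ks) => //; apply: (is_subringM Ks); last first.
      by rewrite -coefficient_mapV.
    by apply: (is_subringD Ks) => //; apply: (is_subring1 Ks).
  have KVwx : other_field (range iota) x k (w j / x j)^-1.
    by apply: subfield_genV.
  by case: (sigma j) => [[]|] [] ->.
have sub_A b : mixed_ring (fun j => if j == k then Some b else sigma j) `<=`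
    subring_gen (A `|` local_generators (Some b) k).
  apply: subring_gen_min; first exact: subring_gen_subring.
  move=> z [Rz | [j]].
    by apply: mem_subring_gen; left; apply: mem_subring_gen; left.
  have [-> | jk] := eqVneq j k => zj; apply: mem_subring_gen; first by right.
  by left; apply: mem_subring_gen; right; exists j.
have : subring_gen (A `|` local_generators None k) u.
  apply: (laurent_intersection As Ax wA (w_neq0 k)).
    exact: (sub_A false).
  exact: (sub_A true).
move: u {Hu}; apply: subring_gen_min; first exact: subring_gen_subring.
move=> z [ | zk]; last by apply: mem_subring_gen; right; exists k; rewrite sk.
move: z; apply: subring_genS => z [Rz | [j _ zj]]; first by left.
by right; exists j.
Qed.

(** Induction on the number of [None]: gluing at such an index reduces it to the two Laurent choices
    there. *)
Lemma upper_mixed_ring (sigma : 'I_n -> option bool) :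
  upper_cluster_algebra iota s `<=` mixed_ring sigma.
Proof.
move=> u Uu; have [m le_m] := ubnP #|[set j | sigma j == None]|%SET.
elim: m => // m IHm in sigma le_m *.
have [[k sk] | no_k] := pselect (exists k, sigma k = None).
  apply: (mixed_ring_glue sk) => b; apply: IHm.
  rewrite -ltnS (leq_trans _ le_m) // ltnS; apply: proper_card; apply/properP.
  split; last by exists k; rewrite !inE ?sk ?eqxx.
  by apply/fintype.subsetP => j; rewrite !inE; case: ifP.
have -> : sigma = fun j => Some (sigma j == Some true).
  apply/funext => j; case E: (sigma j) => [[]|] //.
  by case: no_k; exists j.
exact: upper_mixed_ring_total.
Qed.

Lemma isolated_upper :
  upper_cluster_algebra iota s `<=` cluster_algebra iota s.
Proof.
apply: subset_trans (@upper_mixed_ring (fun=> None)) _.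
apply: subring_gen_min.
  exact: cluster_algebra_subring.
move=> z [Rz | [j [-> | ->]]]; first exact: cluster_algebra_base.
  by apply: cluster_algebra_var; apply: MutRefl.
have [t [st _ _ /(_ j)]] := isolated_equivalent (isT : uniq [:: j]).
by rewrite inE eqxx => <-; apply: cluster_algebra_var.
Qed.

End Isolated.

(** * Denominators and prime ideals *)

Section Denominators.
Variable F : fieldType.
Implicit Types (A I J : set F) (a b u : F).

Lemma localization_denominator A a u : is_subring A -> A a -> a != 0 ->
  subring_gen (A `|` [set a^-1]) u -> exists m, A (a ^+ m * u).
Proof.
move=> As Aa a0; move: u; apply: subring_gen_min; last first.
  move=> u [Au | ->]; first by exists 0%N; rewrite mul1r.
  by exists 1%N; rewrite divff //; apply: is_subring1.
have AX m : A (a ^+ m) by apply: is_subringX.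
split=> [|b c [m Am] [l Al]|b c [m Am] [l Al]].
- by exists 0%N; rewrite mulr1; apply: is_subring1.
- exists (m + l)%N; rewrite mulrBr exprD; apply: is_subringB => //.
    by rewrite mulrAC; apply: is_subringM.
  by rewrite -mulrA; apply: is_subringM.
- by exists (m + l)%N; rewrite exprD mulrACA; apply: is_subringM.
Qed.

(** Expand [(c * a + d * b) ^+ (m + l) = 1]: every term contains [a ^+ m] or [b ^+ l]. *)
Lemma comaximal_denominators A a b c d m l u : is_subring A ->
  A a -> A b -> A c -> A d -> c * a + d * b = 1 ->
  A (a ^+ m * u) -> A (b ^+ l * u) -> A u.
Proof.
move=> As Aa Ab Ac Ad cd1 Aau Abu.
rewrite -[u]mul1r -(expr1n _ (m + l)) -cd1 exprDn mulr_suml.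
apply: (is_subring_sum As) => i _; rewrite -mulr_natl -!mulrA.
apply: (is_subringM As); first exact: (is_subring_int As (Posz _)).
have AX e k : A e -> A (e ^+ k) by apply: is_subringX.
have [li | il] := leqP l i.
  apply: (is_subringM As); first by apply: AX; apply: is_subringM.
  rewrite exprMn -mulrA; apply: (is_subringM As); first exact: AX.
  by rewrite -(subnK li) exprD -mulrA; apply: (is_subringM As) => //; apply: AX.
rewrite mulrCA; apply: (is_subringM As); first by apply: AX; apply: is_subringM.
rewrite exprMn -mulrA; apply: (is_subringM As); first exact: AX.
rewrite -addnBA ?(ltnW il) // addnC exprD -mulrA.
by apply: (is_subringM As) => //; apply: AX.
Qed.

Definition is_ideal A I : Prop :=
  [/\ I `<=` A, I 0, forall a b, I a -> I b -> I (a - b)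
    & forall a b, A a -> I b -> I (a * b)].

(** If [a] is outside [I], maximality puts 1 in the ideal [J] generated by [I] and [a]; multiplying
    [1 = p + r * a] by [b] shows that [b] is in [I]. *)
Lemma maximal_ideal_prime A I : is_subring A -> is_ideal A I -> ~ I 1 ->
  (forall J, is_ideal A J -> I `<=` J -> ~ J 1 -> J `<=` I) ->
  prime_ideal A I.
Proof.
move=> As Iideal I1 Imax; have [IA I0 IB IM] := Iideal; split=> //.
  by split=> [|a b]; rewrite !inE //; apply: IB.
move=> a b Aa Ab Iab; have [Ia | nIa] := pselect (I a); [by left | right].
pose J := [set c | exists p r, [/\ I p, A r & c = p + r * a]].
have ID c d : I c -> I d -> I (c + d).
  by move=> Ic Id; rewrite -[d]opprK -[- d]sub0r; apply: (IB) => //; apply: IB.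
have J1 : J 1.
  apply: contrapT => nJ1; apply: nIa; apply: (Imax J) => //; last first.
  - by exists 0, 1; split=> //; rewrite ?add0r ?mul1r //; apply: is_subring1.
  - move=> c Ic; exists c, 0; split; rewrite ?mul0r ?addr0 //.
    exact: is_subring0.
  split.
  - move=> _ [p [r [Ip Ar ->]]]; apply: is_subringD => //; first exact: IA.
    exact: is_subringM.
  - by exists 0, 0; split; rewrite ?mul0r ?addr0 //; apply: is_subring0.
  - move=> _ _ [p [r [Ip Ar ->]]] [q [t [Iq At ->]]].
    exists (p - q), (r - t); split; [exact: IB | exact: is_subringB | ].
    by rewrite mulrBl opprD addrACA.
  - move=> c _ Ac [p [r [Ip Ar ->]]].
    exists (c * p), (c * r); split; [exact: IM | exact: is_subringM | ].
    by rewrite mulrDr mulrA.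
have [p [r [Ip Ar e1]]] := J1.
rewrite -[b]mul1r e1 mulrDl; apply: ID; first by rewrite mulrC; apply: IM.
by rewrite -mulrA; apply: IM.
Qed.

Lemma prime_ideal_above A J : is_subring A -> is_ideal A J -> ~ J 1 ->
  exists2 I, prime_ideal A I & J `<=` I.
Proof.
move=> As Jideal J1; have [_ J0 _ _] := Jideal.
pose good I := [/\ is_ideal A I, J `<=` I & ~ I 1].
have [C Cgood Ctot | I [Igood Imax]] :=
    @Zorn_bigcup _ [set I | I = set0 \/ good I].
  have [[X CX Xgood] | none] := pselect (exists2 X, C X & good X); last first.
    left; apply/seteqP; split=> // c [X CX Xc].
    by case: (Cgood X CX) => [X0 | Xgood]; [rewrite -X0 | case: none; exists X].
  have good_of Y c : C Y -> Y c -> good Y.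
    by move=> CY Yc; case: (Cgood Y CY) => // Y0; rewrite Y0 in Yc.
  right; split; last 2 first.
  - by case: Xgood => _ JX _ c Jc; exists X => //; apply: JX.
  - by move=> [Y CY Y1]; case: (good_of Y 1 CY Y1) => _ _; apply.
  split.
  - move=> c [Y CY Yc]; case: (good_of Y c CY Yc) => -[YA _ _ _] _ _.
    exact: YA.
  - by exists X => //; case: Xgood => -[].
  - move=> a b [Y CY Ya] [Z CZ Zb].
    case: (good_of Y a CY Ya) => -[_ _ YB _] _ _.
    case: (good_of Z b CZ Zb) => -[_ _ ZB _] _ _.
    case: (Ctot Y Z CY CZ) => [YZ | ZY].
      by exists Z => //; apply: ZB => //; apply: YZ.
    by exists Y => //; apply: YB => //; apply: ZY.
  - move=> a b Aa [Y CY Yb]; exists Y => //.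
    by case: (good_of Y b CY Yb) => -[_ _ _ YM] _ _; apply: YM.
(* The maximal set is not empty, since [J] itself is good and contains 0. *)
have {}Igood : good I.
  case: Igood => // I0; case: (Imax J); last by right; split.
  by rewrite I0; split=> // /(_ 0 J0).
case: (Igood) => Iideal JI I1; exists I => //.
apply: maximal_ideal_prime => // K Kideal IK K1.
apply: contrapT => KI; apply: (Imax K) => //.
by right; split=> //; apply: subset_trans IK.
Qed.

End Denominators.

(** * Acyclic seeds *)

Section Acyclic.

(** Draw an arrow from [j] to [l] when [0 < B l j], and among the vertices with an incoming arrow
    take one that reaches the fewest vertices. If it had an arrow to [m], then [m] would reach
    fewer, as a path from [m] back would close a cycle. *)
Lemma acyclic_sink n (B : 'M[int]_n) :
  skew_symmetrizable B -> acyclic_exchange B -> B != 0 ->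
  exists l j, (forall m, B m l <= 0) /\ B j l < 0.
Proof.
move=> Bs Bac B0.
have [a [b ab]] : exists a b, 0 < B a b.
  apply: contrapT => none; move/eqP: B0; apply; apply/matrixP => a b.
  rewrite mxE; case: (ltgtP (B a b) 0) => // ab; case: none.
    by exists b, a; rewrite skew_symmetrizable_sign.
  by exists a, b.
pose e := [rel j l | 0 < B l j].
have ina : [exists j, 0 < B a j] by apply/existsP; exists b.
case: (@arg_minnP _ a (fun l => [exists j, 0 < B l j])
                      (fun l => #|connect e l|) ina).
move=> l /existsP[j lj] lmin.
exists l, j; split; last by rewrite -skew_symmetrizable_sign.
move=> m; rewrite leNgt; apply/negP => ml.
have /lmin : [exists j, 0 < B m j] by apply/existsP; exists l.
apply/negP; rewrite -ltnNge; apply: proper_card; apply/properP; split.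
  by apply/fintype.subsetP => k; apply: connect_trans; apply: connect1.
exists l; first exact: connect0.
apply/negP => /connectP [p mp lp]; apply: Bac.
by exists l, (m :: p); split=> //=; rewrite ml.
Qed.

Lemma acyclic_freeze (P : semifieldType) (F : fieldType) n (s : seed P F n) i :
  acyclic_exchange (exchange s) ->
  acyclic_exchange (exchange (freeze_seed s i)).
Proof.
move=> sac [j [c [c0 cp cl]]]; apply: sac; exists (lift i j), (map (lift i) c).
split; [by case: c c0 {cp cl} | | by rewrite last_map cl].
rewrite path_map; apply: sub_path cp => k l.
by rewrite !mxE.
Qed.

(** No arrow leaves [l], so one monomial of the exchange relation is 1 and the relation reads
    [x_l' * x_l * o = g + x_j * M], with [g] and [o] invertible coefficients. Dividing by [g] gives
    [c] and [d]. *)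
Lemma sink_comaximal (P : semifieldType) (F : fieldType)
    (iota : group_ring P -> F) n (s : seed P F n) l j :
  regular_seed iota s -> (forall m, exchange s m l <= 0) ->
  exchange s j l < 0 ->
  exists c d, [/\ cluster_algebra iota s c, cluster_algebra iota s d
    & c * cluster s l + d * cluster s j = 1].
Proof.
move=> sreg Bl Bjl; case: (sreg) => iotaP xfree _.
have As := cluster_algebra_subring iota s.
have Ax t k : mutation_equivalent iota s t ->
    cluster_algebra iota s (cluster t k).
  exact: cluster_algebra_var.
have ss := MutRefl iota s.
have AG p : cluster_algebra iota s (iota (gr_elt p)).
  by apply: cluster_algebra_base; exists (gr_elt p).
set g := iota (gr_elt (coeffs s l)).
set o := iota (gr_elt (oplus (coeffs s l) 1%g)).
have g0 : g != 0 by apply: coefficient_map_neq0.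
have o0 : o != 0 by apply: coefficient_map_neq0.
have Axk k (z : int) : 0 <= z -> cluster_algebra iota s (cluster s k ^ z).
  by case: z => // m _; apply: (is_subringX As); apply: Ax.
have pos_ge0 (z : int) : 0 <= pos_part z by rewrite /pos_part le_max lexx orbT.
(* [M] is the other monomial with one factor [x_j] removed; the negative entry at [(j, l)] keeps the
   remaining exponent nonnegative. *)
pose M := cluster s j ^ (pos_part (- exchange s j l) - 1)
  * \prod_(k | k != j) cluster s k ^ pos_part (- exchange s k l).
have exch : cluster (mutate iota s l) l * cluster s l * o =
    g + cluster s j * M.
  rewrite ffunE eqxx big1 => [|k _]; last by rewrite pos_part_eq0 // expr0z.
  have x0 := free_family_neq0 l xfree.
  rewrite mulr1 invfM mulrA divfK // divfK // /M mulrA; congr (_ + _).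
  rewrite (bigD1 j) //=; congr (_ * _).
  have xj0 := free_family_neq0 j xfree.
  by rewrite -{2}[cluster s j]expr1z -expfzDr // addrC subrK.
exists (cluster (mutate iota s l) l * o / g), (- (M / g)).
split.
- rewrite /g /o -coefficient_mapV //; apply: (is_subringM As) => //.
  by apply: (is_subringM As) => //; exact: (Ax _ _ (MutMutate l ss)).
- rewrite /g /o -coefficient_mapV //; apply: (is_subringN As).
  apply: (is_subringM As) => //; apply: (is_subringM As).
    apply: Axk; rewrite pos_part_id ?oppr_ge0 ?(ltW Bjl) // subr_ge0.
    by rewrite -gtz0_ge1 oppr_gt0.
  by apply: (is_subring_prod As) => k _; apply: Axk.
- rewrite mulrAC [_ * o * _]mulrAC exch mulrDl divff // mulNr.
  by rewrite [_ * M]mulrC mulrAC addrK.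
Qed.

Lemma acyclic_upper (F : fieldType) n (P : semifieldType)
    (iota : group_ring P -> F) (s : seed P F n) :
  regular_seed iota s -> acyclic_exchange (exchange s) ->
  upper_cluster_algebra iota s `<=` cluster_algebra iota s.
Proof.
(* Freezing changes the semifield and [iota] along with the rank, so the induction generalizes over
   all of them. *)
have [m] := ubnP n; elim: m => // m IHm in n P iota s *.
rewrite ltnS => nm sreg sac.
have [B0 | B0] := eqVneq (exchange s) 0; first exact: isolated_upper.
case: (sreg) => _ xfree Bs.
have [l [j [Bl Bjl]]] := acyclic_sink Bs sac B0.
have [c [d [Ac Ad cd1]]] := sink_comaximal sreg Bl Bjl.
have As := cluster_algebra_subring iota s.
have Ax k : cluster_algebra iota s (cluster s k).
  by apply: cluster_algebra_var; apply: MutRefl.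
move=> u Uu.
have denom i : exists N, cluster_algebra iota s (cluster s i ^+ N * u).
  apply: (localization_denominator As (Ax i) (free_family_neq0 i xfree)).
  apply: cluster_algebra_freeze => //; apply: IHm.
  - by rewrite (leq_trans _ nm) // prednK // (leq_ltn_trans _ (ltn_ord i)).
  - exact: freeze_regular.
  - exact: acyclic_freeze.
  - exact: upper_cluster_algebra_freeze.
have [N AN] := denom l; have [N' AN'] := denom j.
exact: comaximal_denominators As (Ax l) (Ax j) Ac Ad cd1 AN AN'.
Qed.

End Acyclic.

(** * Locally acyclic cluster algebras *)

Section LocallyAcyclic.
Variable F : fieldType.

Definition regular_based (b : based_seed F) : Prop :=
  regular_seed (base_iota b) (base_seed b).

(** The last two clauses ensure that the inverted product consists of variables of a single cluster,
    hence of nonzero elements of the cluster algebra. *)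
Lemma is_freezing_sub (b c : based_seed F) v :
  is_freezing b v c -> regular_based b ->
  [/\ regular_based c,
      upper_cluster_algebra (base_iota b) (base_seed b) `<=`
        upper_cluster_algebra (base_iota c) (base_seed c),
      forall j, range (cluster (base_seed b)) (cluster (base_seed c) j)
    & forall z, z \in v -> range (cluster (base_seed b)) z].
Proof.
move=> + breg; elim=> [|{}v {}c i _ [creg Uc cb vb]].
  by split=> // j; exists j.
split.
- exact: freeze_regular.
- by apply: subset_trans Uc _; apply: upper_cluster_algebra_freeze.
- by move=> j; rewrite ffunE; apply: cb.
- by move=> z; rewrite inE => /orP[/eqP -> | /vb].
Qed.

Lemma locally_acyclic_upper (P : semifieldType) (iota : group_ring P -> F) n
    (s : seed P F n) : regular_seed iota s -> locally_acyclic iota s ->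
  upper_cluster_algebra iota s `<=` cluster_algebra iota s.
Proof.
move=> sreg [C [Cloc Ccover] Ciso] u Uu.
have As := cluster_algebra_subring iota s.
pose J := [set b | cluster_algebra iota s b /\ cluster_algebra iota s (b * u)].
have Jideal : is_ideal (cluster_algebra iota s) J.
  split.
  - by move=> b [].
  - by split; rewrite ?mul0r; apply: (is_subring0 As).
  - move=> a b [Aa Aau] [Ab Abu]; rewrite /J /= mulrBl.
    by split; apply: (is_subringB As).
  - move=> a b Aa [Ab Abu]; rewrite /J /= -mulrA.
    by split; apply: (is_subringM As).
suff [_] : J 1 by rewrite mul1r.
apply: contrapT => J1.
have [I Iprime JI] := prime_ideal_above As Jideal J1.
have [c Cc [_ cproper]] := Ccover I Iprime.
have [t [v [st tc cE]]] := Cloc c Cc.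
have treg := mutation_equivalent_regular st sreg.
have [creg Utc _ vt] :=
  is_freezing_sub tc (treg : regular_based (BasedSeed iota t)).
(* The localization [c] is isolated, so its upper cluster algebra, which contains [u], lies in its
   cluster algebra. *)
have Uc : base_algebra c u.
  apply: isolated_upper => //; first by apply: (Ciso c Cc); apply: MutRefl.
  apply: Utc; exact: (upper_cluster_algebra_equivalent st).
set w := \prod_(z <- v) z in cE.
have vA z : z \in v -> cluster_algebra iota s z /\ z != 0.
  move=> /vt [j _ <-]; split; first exact: cluster_algebra_var.
  by case: treg => _ tfree _; apply: (free_family_neq0 _ tfree).
have [Aw w0] : cluster_algebra iota s w /\ w != 0.
  split; last by rewrite prodf_seq_neq0; apply/allP => z /vA[].
  rewrite /w big_seq; apply: (is_subring_prod As) => z zv.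
  by case: (vA z zv).
have [m Amu] : exists m, cluster_algebra iota s (w ^+ m * u).
  by apply: localization_denominator => //; rewrite -cE.
have Iw : I (w ^+ m) by apply: JI; split=> //; apply: (is_subringX As).
have cs : is_subring (base_algebra c) := cluster_algebra_subring _ _.
have cV : base_algebra c (w ^+ m)^-1.
  rewrite -exprVn; apply: (is_subringX cs); rewrite cE.
  by apply: mem_subring_gen; right.
(* [w ^+ m] lies in [I] and is a unit of the localization, so [I] extends to the whole ring, against
   [cproper]. *)
apply: cproper => a ca K [/= _ KI]; apply: KI.
exists (a * (w ^+ m)^-1); first exact: (is_subringM cs).
by exists (w ^+ m); rewrite // divfK ?expf_neq0.
Qed.

End LocallyAcyclic.

Theorem theorem2 (laurent : laurent_phenomenon)
    (P : semifieldType) (F : fieldType)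
    (iota : {rmorphism group_ring P -> F}) (iota_inj : injective iota)
    (n : nat) (s : seed P F n) (s_seed : is_seed iota s) :
  acyclic iota s \/ locally_acyclic iota s ->
  cluster_algebra iota s = upper_cluster_algebra iota s.
Proof.
move=> s_ac; apply/seteqP; split; first exact: laurent.
have sreg : regular_seed iota s.
  case: s_seed => -[xind _] Bs; split=> //.
    exact: rmorphism_coefficient_map.
  exact: alg_independent_free.
case: s_ac => [[t st tac] | sloc]; last exact: locally_acyclic_upper.
apply: subset_trans (upper_cluster_algebra_equivalent st) _.
apply: subset_trans (cluster_algebra_equivalent st).
apply: acyclic_upper => //; exact: mutation_equivalent_regular sreg.
Qed.
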